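(* (1) If a second order ordinary differential equation of the form $y''=f(x,y,y')$ has $\mathrm{sl}(3,\mathbb{R})$ as its symmetry algebra, then the canonical coordinates for the maximal abelian subalgebra of ad-nilpotent elements of maximal rank (namely rank $2$) of the symmetry algebra give linearizing coordinates for the given equation, and in these coordinates the equation is $y''=0$. (2) If a system of second order ordinary differential equations of the form $$y''(x)=f(x,y,z,y',z'),\qquad z''(x)=g(x,y,z,y',z')$$ has $\mathrm{sl}(4,\mathbb{R})$ as its symmetry algebra, then the canonical coordinates for the maximal abelian subalgebra of ad-nilpotent elements of maximal rank (namely rank $3$) of the symmetry algebra give linearizing coordinates for the given system, and in these coordinates the system becomes $y''(x)=0=z''(x)$.
   Context: The symmetry algebra of an equation (or system) is its Lie algebra of infinitesimal point symmetries: vector fields on the space of independent and dependent variables (the $(x,y)$-plane in (1), $(x,y,z)$-space in (2)) whose second prolongations are tangent to the submanifold defined by the equation (or system) in the space with coordinates $(x,y,y',y'')$, respectively $(x,y,z,y',z',y'',z'')$. All statements are local. The (geometric) rank of a Lie algebra of vector fields is the dimension of its generic orbit, i.e. the generic rank of the matrix of coefficients of a basis. ''The maximal abelian subalgebra of ad-nilpotent elements of maximal rank'' is the following subalgebra, determined up to conjugation: fix a split Cartan subalgebra and a choice of positive roots (equivalently, a Borel subalgebra); among the abelian subalgebras spanned by root vectors for positive roots (i.e. in the nil-radical of the Borel subalgebra) that are maximal with this property, take the one whose geometric rank is the largest possible, which is $2$ for $\mathrm{sl}(3,\mathbb{R})$ and $3$ for $\mathrm{sl}(4,\mathbb{R})$.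 Canonical coordinates for such an abelian subalgebra, of dimension equal to its rank, are local coordinates $(u,v)$, respectively $(u,v,w)$, in which a basis of root vectors of the subalgebra becomes $\partial_u,\partial_v$, respectively $\partial_u,\partial_v,\partial_w$. One of the canonical coordinates is declared to be the independent variable and the remaining ones the dependent variables; these are renamed $x,y$ (respectively $x,y,z$) in the conclusions. *)

(* Defs.v *)
From HB Require Import structures.
From mathcomp Require Export all_boot all_order all_algebra.
From mathcomp Require Export all_classical all_reals all_analysis.

Set Implicit Arguments.
Unset Strict Implicit.
Unset Printing Implicit Defensive.

Import Order.TTheory GRing.Theory Num.Theory.
Import numFieldNormedType.Exports.
Local Open Scope classical_set_scope.
Local Open Scope ring_scope.

(* Coordinate-free C^k: on a finite-dimensional V and an open D this is the
   usual notion, since the directional derivatives include all iterated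
   partial derivatives. *)
Fixpoint class_C (R : realType) (V W : normedModType R)
    (k : nat) (D : set V) (f : V -> W) : Prop :=
  (forall x, D x -> {for x, continuous f}) /\
  if k is k'.+1 then
    forall v, (forall x, D x -> derivable f x v) /\
              class_C k' D (fun x => 'D_v f x)
  else True.

Definition smooth (R : realType) (V W : normedModType R)
    (D : set V) (f : V -> W) : Prop :=
  forall k, class_C k D f.

Section JetSpaces.
Variables (R : realType) (m : nat).

(* A point z of J0 has coordinates (x, y^1, ..., y^m), the independent variable
   x being entry 0; points of J1 and J2 are (z, p) and ((z, p), q) with p = y'
   and q = y''. *)
Definition J0 : normedModType R := 'rV[R]_(1 + m).
Definition J1 : normedModType R := (J0 * 'rV[R]_m)%type.
Definition J2 : normedModType R := (J1 * 'rV[R]_m)%type.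

Definition indep (z : J0) : R := lsubmx z 0 0.
Definition dep (z : J0) : 'rV[R]_m := rsubmx z.

(* Total derivatives D_x = d/dx + p d/dy (+ q d/dp), as derivatives in the
   direction (1, p), resp. ((1, p), q). *)
Definition contact (p : 'rV[R]_m) : J0 := row_mx (const_mx 1) p.

Definition Dx1 (W : normedModType R) (F : J0 -> W) (j : J1) : W :=
  'D_(contact j.2) F j.1.

Definition Dx2 (W : normedModType R) (F : J1 -> W) (j : J2) : W :=
  'D_((contact j.1.2, j.2) : J1) F j.1.

Definition vfield := J0 -> J0.

Definition bracket (X Y : vfield) : vfield :=
  fun z => 'D_(X z) Y z - 'D_(Y z) X z.

(* Prolongations of X = xi d/dx + eta d/dy:
     eta1 = D_x eta - (D_x xi) p,   eta2 = D_x eta1 - (D_x xi) q. *)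
Definition eta1 (X : vfield) (j : J1) : 'rV[R]_m :=
  Dx1 (dep \o X) j - Dx1 (indep \o X) j *: j.2.

Definition eta2 (X : vfield) (j : J2) : 'rV[R]_m :=
  Dx2 (eta1 X) j - Dx1 (indep \o X) j.1 *: j.2.

Definition prolong1 (X : vfield) (j : J1) : J1 := (X j.1, eta1 X j).

Definition prolong2 (X : vfield) (j : J2) : J2 := (prolong1 X j.1, eta2 X j).

Section Equation.
(* The system y'' = f(x, y, y'), with f given on Om. *)
Variables (Om : set J1) (f : J1 -> 'rV[R]_m).

Definition base : set J0 := [set j.1 | j in Om].

Definition on_equation (j : J2) : Prop := Om j.1 /\ j.2 = f j.1.

Definition symmetry (X : vfield) : Prop :=
  smooth base X /\
  forall j : J2, on_equation j ->
    'D_(prolong2 X j) (fun k : J2 => k.2 - f k.1) j = 0.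

Definition slv (n : nat) : {vspace 'M[R]_n} :=
  lker (linfun (@mxtrace R n : 'M[R]_n -> R^o)).

Definition mxbracket (n : nat) (X Y : 'M[R]_n) : 'M[R]_n := X *m Y - Y *m X.

(* phi identifies sl(n, R) with the symmetry algebra. Vector fields are
   compared on base only, and the values of phi outside slv n are irrelevant. *)
Definition sl_is_symmetry_algebra (n : nat) (phi : 'M[R]_n -> vfield) : Prop :=
  [/\ forall X, X \in slv n -> symmetry (phi X),
      forall a X Y, X \in slv n -> Y \in slv n ->
        {in base, phi (a *: X + Y) =1 fun z => a *: phi X z + phi Y z},
      forall X Y, X \in slv n -> Y \in slv n ->
        {in base, phi (mxbracket X Y) =1 bracket (phi X) (phi Y)},
      forall X, X \in slv n -> {in base, phi X =1 fun=> 0} -> X = 0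
    & forall S, symmetry S ->
        exists2 X, X \in slv n & {in base, phi X =1 S}].

End Equation.

Section RootVectors.
Variable n : nat.

(* Cartan subalgebras of a semisimple Lie algebra are abelian, so they are the
   abelian self-normalizing ones; split means that each ad H is diagonalizable
   over R. *)
Definition split_cartan (h : {vspace 'M[R]_n}) : Prop :=
  [/\ (h <= slv n)%VS,
      forall H H', H \in h -> H' \in h -> mxbracket H H' = 0,
      forall X, X \in slv n ->
        (forall H, H \in h -> mxbracket H X \in h) -> X \in h
    & forall H, H \in h -> exists2 s : seq 'M[R]_n,
        span s = slv n &
        forall X, X \in s -> exists a : R, mxbracket H X = a *: X].

Definition dual (h : {vspace 'M[R]_n}) := 'Hom(subvs_of h, R^o).

Definition root_vector (h : {vspace 'M[R]_n}) (al : dual h)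
    (X : 'M[R]_n) : Prop :=
  [/\ X \in slv n, X != 0
    & forall H : subvs_of h, mxbracket (vsval H) X = (al H : R) *: X].

Definition is_root (h : {vspace 'M[R]_n}) (al : dual h) : Prop :=
  al != 0 /\ exists X, root_vector al X.

Definition positive_roots (h : {vspace 'M[R]_n}) (P : set (dual h)) : Prop :=
  [/\ forall al, P al -> is_root al,
      forall al, is_root al -> P al \/ P (- al),
      forall al, ~ (P al /\ P (- al))
    & forall al be, P al -> P be -> is_root (al + be) -> P (al + be)].

Definition positive_abelian (h : {vspace 'M[R]_n}) (P : set (dual h))
    (A : {vspace 'M[R]_n}) : Prop :=
  (exists2 s : seq 'M[R]_n, A = span s &
     forall X, X \in s -> exists2 al, P al & root_vector al X) /\
  forall X Y, X \in A -> Y \in A -> mxbracket X Y = 0.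

Definition maximal_positive_abelian (h : {vspace 'M[R]_n}) (P : set (dual h))
    (A : {vspace 'M[R]_n}) : Prop :=
  positive_abelian P A /\
  forall B, positive_abelian P B -> (A <= B)%VS -> B = A.

Variables (U : set J0) (phi : 'M[R]_n -> vfield).

Definition rank_at (A : {vspace 'M[R]_n}) (z : J0) : nat :=
  \rank (\matrix_(i < \dim A) (phi (vbasis A)`_i z : 'rV[R]_(1 + m))).

(* The generic rank is the largest rank attained on U. *)
Definition geometric_rank (A : {vspace 'M[R]_n}) : nat :=
  \max_(r < m.+2 | `[< exists2 z, U z & rank_at A z = r >]) r.

Definition maximal_rank_abelian (h : {vspace 'M[R]_n}) (P : set (dual h))
    (A : {vspace 'M[R]_n}) : Prop :=
  maximal_positive_abelian P A /\
  forall B, maximal_positive_abelian P B ->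
    (geometric_rank B <= geometric_rank A)%N.

(* w : V -> R^(1+m) is a local coordinate system in which the basis e of root
   vectors is d/dw^0, ..., d/dw^m. The last clause makes the derivative of w
   bijective, so w is a diffeomorphism onto an open set. Since the
   ordering of e is free, fixing w^0 as the new independent variable covers
   every choice of the independent variable among the canonical coordinates. *)
Definition canonical_coordinates (h : {vspace 'M[R]_n}) (P : set (dual h))
    (A : {vspace 'M[R]_n}) (V : set J0) (w : J0 -> J0) : Prop :=
  [/\ open V, V `<=` U, smooth V w, {in V &, injective w}
    & exists e : (1 + m).-tuple 'M[R]_n,
      [/\ basis_of A e,
          forall i, exists2 al, P al & root_vector al (tnth e i)
        & forall i z, V z ->
            'D_(phi (tnth e i) z) w z = delta_mx 0 i :> 'rV[R]_(1 + m)]].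

End RootVectors.

(* First and second derivatives of the new dependent variables dep \o w with
   respect to the new independent variable indep \o w, as functions on the jet
   spaces; meaningful where D_x (indep \o w) != 0. *)
Definition new_p (w : J0 -> J0) (j : J1) : 'rV[R]_m :=
  (Dx1 (indep \o w) j)^-1 *: Dx1 (dep \o w) j.

Definition new_q (w : J0 -> J0) (j : J2) : 'rV[R]_m :=
  (Dx1 (indep \o w) j.1)^-1 *: Dx2 (new_p w) j.

(* In the coordinates w on V, the equation y'' = f is (new y)'' = 0. *)
Definition becomes_trivial (Om : set J1) (f : J1 -> 'rV[R]_m)
    (V : set J0) (w : J0 -> J0) : Prop :=
  forall j : J2, Om j.1 -> V j.1.1 -> Dx1 (indep \o w) j.1 != 0 ->
    (j.2 = f j.1 <-> new_q w j = 0).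

End JetSpaces.

(* Main.v *)
(* The maximal rank is found pointwise: the elements vanishing at a point z form
   a subalgebra, so where the highest root vector E_1n does not vanish, the
   Heisenberg relations [E_1k, E_kn] = E_1n force enough positive root vectors
   to be independent at z.

   Let A be a positive abelian subalgebra with a basis e_i of root vectors such
   that the fields E_i = phi(e_i) form a frame.  As A is abelian, no index is
   both the row of one of its root vectors and the column of another, whence an
   H with [X, H] = X for all X in A.  Writing phi(H) = sum_i g_i E_i, this
   bracket relation says E_j(g_i) = delta_ij: the g_i are canonical coordinates,
   and no integration is needed.

   Let w be any canonical coordinates.  Subtracting constant multiples of the
   E_i from phi(H) gives, for each z, a symmetry Z vanishing at z with linear
   part the identity.  Its first prolongation vanishes on the fibre over z, so
   the symmetry condition there reads eta2(Z) = 0, which determines f(z, p) from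
   the second derivative of Z in the direction (1, p).  That derivative is minus
   the second derivative of w, expressed in the frame, and the resulting
   equation is new_q = 0. *)
Require Import Defs.
From HB Require Import structures.
From mathcomp Require Import ring lra.
From mathcomp.real_closed Require Import complex.
Import Order.TTheory GRing.Theory Num.Theory.
Import numFieldNormedType.Exports.
Local Open Scope classical_set_scope.
Local Open Scope ring_scope.

Set Implicit Arguments.
Unset Strict Implicit.
Unset Printing Implicit Defensive.

(** * Matrices and Cartan subalgebras *)

(** Reduces a linear identity on [slv] or on an abelian subalgebra to a spanning list, typically of
    ad-eigenvectors or root vectors. *)
Lemma span_ind (K : fieldType) (vT : vectType K) (s : seq vT)
    (Q : vT -> Prop) :
  Q 0 -> (forall a x y, Q x -> Q y -> Q (a *: x + y)) ->
  (forall x, x \in s -> Q x) -> forall x, x \in span s -> Q x.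
Proof.
move=> Q0 Qlin Qs x xs; rewrite (@coord_span _ _ _ (in_tuple s) _ xs).
elim/big_ind: _ => // [y z Qy Qz|i _]; first by rewrite -[y]scale1r; exact: Qlin.
by rewrite -[_ *: _]addr0; apply: Qlin => //; apply: Qs; rewrite mem_nth.
Qed.

Lemma mul_rV_delta (K : comNzRingType) (n : nat) (u : 'rV[K]_n) (i j : 'I_n) :
  u *m delta_mx i j = u 0 i *: delta_mx 0 j.
Proof.
rewrite -(mul_delta_mx (0 : 'I_1)) mulmxA -colE -mul_scalar_mx; congr (_ *m _).
by apply/matrixP => k l; rewrite !ord1 !mxE eqxx mulr1n.
Qed.

Section SlMatrices.
Variables (R : realType) (n : nat).
Implicit Types X Y H : 'M[R]_n.

Lemma mem_slv X : (X \in slv R n) = (\tr X == 0).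
Proof. by rewrite memv_ker lfunE. Qed.

Lemma mxtrace_delta (i j : 'I_n) : \tr (delta_mx i j : 'M[R]_n) = (i == j)%:R.
Proof.
rewrite /mxtrace (bigD1 i) //= big1 ?addr0 => [|k ki]; rewrite mxE ?eqxx //.
by rewrite (negPf ki).
Qed.

Lemma delta_slv (i j : 'I_n) : i != j -> (delta_mx i j : 'M[R]_n) \in slv R n.
Proof. by move=> /negPf ij; rewrite mem_slv mxtrace_delta ij. Qed.

Lemma mxbracket_slv X Y : mxbracket X Y \in slv R n.
Proof. by rewrite mem_slv /mxbracket mxtraceD raddfN /= mxtrace_mulC subrr. Qed.

Lemma mxbracketC X Y : mxbracket X Y = - mxbracket Y X.
Proof. by rewrite /mxbracket opprB. Qed.

Lemma mxbracketDr X Y Z a :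
  mxbracket Z (a *: X + Y) = a *: mxbracket Z X + mxbracket Z Y.
Proof.
rewrite /mxbracket mulmxDr mulmxDl -scalemxAr -scalemxAl scalerBr opprD.
by rewrite addrACA.
Qed.

Lemma mxbracketDl X Y Z a :
  mxbracket (a *: X + Y) Z = a *: mxbracket X Z + mxbracket Y Z.
Proof. by rewrite mxbracketC mxbracketDr opprD -scalerN -!mxbracketC. Qed.

Lemma mxbracketxx X : mxbracket X X = 0.
Proof. exact: subrr. Qed.

Lemma mxbracket0r X : mxbracket X 0 = 0.
Proof. by rewrite /mxbracket mulmx0 mul0mx subrr. Qed.

Lemma mxbracket_jacobi X Y Z :
  mxbracket X (mxbracket Y Z) =
  mxbracket (mxbracket X Y) Z + mxbracket Y (mxbracket X Z).
Proof.
rewrite /mxbracket !mulmxBr !mulmxBl !mulmxA !opprB.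
by apply/matrixP=> i j; rewrite !mxE; ring.
Qed.

End SlMatrices.

(** * Real eigenvalues of ad-diagonalizable matrices *)

Section AdDiagonalizable.
Variables (R : realType) (n' : nat).
Let n := n'.+1.
Implicit Types X Y H : 'M[R]_n.

(* For a left eigenrow psi of H with eigenvalue lam and a right eigencolumn w
   with eigenvalue mu, [H, E] = a E gives (lam - mu - a) psi E w = 0. *)
Lemma ad_diagonalizable_real_eigenvalue H (s : seq 'M[R]_n) :
  span s = slv R n ->
  (forall X, X \in s -> exists a : R, mxbracket H X = a *: X) ->
  exists (lam : R) (psi : 'rV[R]_n), psi != 0 /\ psi *m H = lam *: psi.
Proof.
move=> ss sE; pose toC := map_mx (real_complex R).
have [lam] := @Theorem7' R n (toC _ _ H) isT.
case/eigenvalueP => psi psiH psi0.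
(* For a real [lam] both the real and the imaginary part of [psi] satisfy the eigenvalue equation,
   and one of them is nonzero. *)
have [Iml|Iml] := eqVneq (complex.Im lam) 0.
  case: lam Iml psiH => x y /= -> psiH.
  have mapE (g : {additive R[i] -> R}) :
    (forall (a : R) z, g (a%:C%C * z) = a * g z) ->
    map_mx g psi *m H = x *: map_mx g psi.
    move=> gZ; apply/rowP=> j; move/rowP/(_ j): psiH; rewrite !mxE => /(congr1 g).
    rewrite raddf_sum /= gZ => <-; apply: eq_bigr => i _.
    by rewrite !mxE mulrC -gZ mulrC.
  have Rez (a : R) z : complex.Re (a%:C%C * z) = a * complex.Re z.
    by case: z => z1 z2 /=; rewrite mul0r subr0.
  have Imz (a : R) z : complex.Im (a%:C%C * z) = a * complex.Im z.
    by case: z => z1 z2 /=; rewrite mul0r addr0.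
  have [Re0|Re0] := eqVneq (map_mx (@complex.Re R) psi) 0; last first.
    exists x, (map_mx (@complex.Re R) psi); split=> //.
    exact: (mapE (@complex.Re R)).
  exists x, (map_mx (@complex.Im R) psi); split; last exact: (mapE (@complex.Im R)).
  apply: contraNneq psi0 => Im0; apply/eqP/rowP=> j; rewrite mxE.
  move/rowP/(_ j): Re0; move/rowP/(_ j): Im0; rewrite !mxE.
  by case: (psi 0 j) => a b /= -> ->.
(* If [lam] is not real, its conjugate is an eigenvalue too, with a right eigencolumn [w^T]. The
   difference of the two is not real, so it equals no ad-eigenvalue [a], and [psi E w] vanishes on
   all of sl(n). *)
exfalso.
have psicH : map_mx (@conjc R) psi *m toC _ _ H =
    conjc lam *: map_mx (@conjc R) psi.
  rewrite -map_mxZ -psiH map_mxM; congr (_ *m _).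
  by apply/matrixP=> i j; rewrite !mxE /= oppr0.
have [w w0 wH] : exists2 w : 'rV_n, w != 0 &
    w *m (toC _ _ H)^T = conjc lam *: w.
  have : \det (toC _ _ H - (conjc lam)%:M) == 0.
    apply/det0P; exists (map_mx (@conjc R) psi).
      apply: contraNneq psi0 => /rowP p0; apply/eqP/rowP=> j; move: (p0 j).
      by rewrite !mxE => /eqP; rewrite conjc_eq0 => /eqP.
    by rewrite mulmxBr psicH mul_mx_scalar subrr.
  rewrite -det_tr => /det0P[w w0 wE]; exists w => //.
  move: wE; rewrite linearB /= tr_scalar_mx mulmxBr mul_mx_scalar => /eqP.
  by rewrite subr_eq0 => /eqP.
have Hw : toC _ _ H *m w^T = conjc lam *: w^T.
  by rewrite -[toC _ _ H]trmxK -trmx_mul wH linearZ.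
have lamc : lam - conjc lam != 0.
  case: lam Iml {psiH psicH wH Hw} => x y /= y0.
  rewrite subr_eq0 eq_complex /= eqxx /=.
  by rewrite -subr_eq0 opprK -mulr2n mulrn_eq0.
have pw : psi *m w^T = 0.
  have : lam *: (psi *m w^T) = conjc lam *: (psi *m w^T).
    by rewrite scalemxAl -psiH -mulmxA Hw scalemxAr.
  move/eqP; rewrite -subr_eq0 -scalerBl scaler_eq0 (negPf lamc) /=.
  by move/eqP.
have pEw E : E \in slv R n -> psi *m toC _ _ E *m w^T = 0.
  rewrite -ss; apply: (span_ind (Q := fun E => psi *m toC _ _ E *m w^T = 0)).
  - by rewrite /toC map_mx0 mulmx0 mul0mx.
  - move=> a X Y hX hY; rewrite /toC map_mxD map_mxZ /= mulmxDr mulmxDl.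
    by rewrite -scalemxAr -scalemxAl hX hY scaler0 addr0.
  move=> X /sE[a HX].
  have : psi *m toC _ _ (mxbracket H X) *m w^T =
         a%:C%C *: (psi *m toC _ _ X *m w^T).
    by rewrite HX /toC map_mxZ -scalemxAr -scalemxAl.
  rewrite /mxbracket /toC map_mxB !map_mxM mulmxBr mulmxBl !mulmxA psiH.
  rewrite -2!scalemxAl -[_ *m map_mx _ H *m _]mulmxA Hw -scalemxAr -scalerBl.
  move/eqP; rewrite -subr_eq0 -scalerBl scaler_eq0 => /orP[|/eqP//].
  case: lam Iml {psiH psicH wH Hw lamc} => x y /= y0.
  rewrite eq_complex /= => /andP[_]; rewrite !subr0 opprK -mulr2n mulrn_eq0.
  by rewrite (negPf y0).
(* Off-diagonal units handle distinct indices. On the diagonal, [T] is a traceless substitute for a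
   unit, and its identity part contributes nothing because [psi w] is zero. *)
have ij0 i j : psi 0 i * w 0 j = 0.
  have [->|ij] := eqVneq i j; last first.
    have := pEw _ (delta_slv R ij).
    rewrite /toC map_delta_mx mul_rV_delta -scalemxAl -rowE => /matrixP/(_ 0 0).
    by rewrite !mxE.
  pose T : 'M[R]_n := n%:R *: delta_mx j j - 1%:M.
  have : T \in slv R n.
    rewrite mem_slv /T mxtraceD raddfN /= mxtraceZ mxtrace1.
    by rewrite mxtrace_delta eqxx mulr1 subrr.
  move/pEw; rewrite /toC map_mxB map_mxZ map_delta_mx map_mx1 mulmxBr mulmx1.
  rewrite mulmxBl pw subr0 -scalemxAr -scalemxAl mul_rV_delta -scalemxAl -rowE.
  move/matrixP/(_ 0 0); rewrite !mxE => /eqP; rewrite mulf_eq0 => /orP[|/eqP//].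
  by rewrite eq_complex /= pnatr_eq0.
move/rV0Pn: psi0 => [i pi]; move/rV0Pn: w0 => [j wj].
by have /eqP := ij0 i j; rewrite mulf_eq0 (negPf pi) (negPf wj).
Qed.

End AdDiagonalizable.

(** * Simultaneous diagonalization of a split Cartan subalgebra *)

Section SplitCartan.
Variables (R : realType) (n' : nat).
Let n := n'.+1.
Implicit Types X Y H Q : 'M[R]_n.

Lemma mul_eigen_horner_mx H (v : 'rV[R]_n) (r : R) (p : {poly R}) :
  v *m H = r *: v -> v *m horner_mx H p = p.[r] *: v.
Proof.
move=> vH; elim/poly_ind: p => [|p c IHp]; first by rewrite rmorph0 mulmx0 horner0 scale0r.
rewrite rmorphD rmorphM /= horner_mx_X horner_mx_C mulmxDr mulmxA IHp.
by rewrite -scalemxAl vH mul_mx_scalar scalerA -scalerDl !hornerE.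
Qed.

(* With psi H = lam psi and [H, E] = a E, the row psi E is an eigenrow of H
   with eigenvalue lam - a; these rows and psi span everything. *)
Lemma ad_diagonalizable_diagonalizable H (s : seq 'M[R]_n) :
  span s = slv R n ->
  (forall X, X \in s -> exists a : R, mxbracket H X = a *: X) ->
  diagonalizable H.
Proof.
move=> ss sE.
have [lam [psi [psi0 psiH]]] := ad_diagonalizable_real_eigenvalue ss sE.
have /boolp.choice[a aE] (X : 'M[R]_n) :
    exists r : R, X \in s -> mxbracket H X = r *: X.
  by have [/sE[r HX]|_] := boolP (X \in s); [exists r | exists 0].
apply/diagonalizableP.
pose rs := undup (lam :: map (fun X => lam - a X) s).
exists rs; first exact: undup_uniq.
(* The minimal polynomial has to divide a product of distinct linear factors, so it remains to show
   that [M] is zero. *)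
apply: mxminpoly_min; set q := \prod_(x <- rs) _; set M := horner_mx H q.
have kill r (v : 'rV[R]_n) : r \in lam :: map (fun X => lam - a X) s ->
    v *m H = r *: v -> v *m M = 0.
  move=> rrs vH; rewrite (mul_eigen_horner_mx _ vH).
  suff /rootP -> : root q r by rewrite scale0r.
  by rewrite root_prod_XsubC mem_undup.
have psiM : psi *m M = 0 by apply: (kill lam); rewrite ?mem_head.
have psiEM E : E \in slv R n -> psi *m E *m M = 0.
  rewrite -ss; apply: (span_ind (Q := fun E => psi *m E *m M = 0)).
  - by rewrite mulmx0 mul0mx.
  - move=> c X Y hX hY; rewrite mulmxDr mulmxDl -scalemxAr -scalemxAl hX hY.
    by rewrite scaler0 addr0.
  move=> X Xs; apply: (kill (lam - a X)).
    by rewrite inE (map_f (fun X => lam - a X) Xs) orbT.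
  have := aE _ Xs; rewrite /mxbracket => /(canRL (subrK _)) HX.
  rewrite scalerBl scalemxAl -psiH -[psi *m H *m X]mulmxA HX mulmxDr mulmxA.
  by rewrite -scalemxAr [X in X - _]addrC addrK.
have [i pi] := rV0Pn psi psi0.
(* Multiplying [psi] by the unit at [(i, j)] isolates row [j] of [M], up to the nonzero factor
   [psi 0 i]. Row [i] then follows from [psiM]. *)
have rowM j : j != i -> row j M = 0.
  rewrite eq_sym => /(delta_slv R) /psiEM; rewrite mul_rV_delta -scalemxAl -rowE.
  by move/eqP; rewrite scaler_eq0 (negPf pi) => /eqP.
apply/row_matrixP => j; rewrite row0; have [->|/rowM//] := eqVneq j i.
move: psiM; rewrite mulmx_sum_row (bigD1 i) //= big1 ?addr0; last first.
  by move=> k /rowM ->; rewrite scaler0.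
by move/eqP; rewrite scaler_eq0 (negPf pi) => /eqP.
Qed.

(** Locked so that conjugation unfolds only through [cmxE] and stays opaque in entry
    computations. *)
Definition cmx : 'M[R]_n -> 'M[R]_n -> 'M[R]_n :=
  locked (fun Q X => Q *m X *m invmx Q).

Lemma cmxE Q X : cmx Q X = Q *m X *m invmx Q.
Proof. by rewrite /cmx -lock. Qed.

Lemma cmx0 Q : cmx Q 0 = 0.
Proof. by rewrite cmxE mulmx0 mul0mx. Qed.

Lemma cmxM Q X Y : Q \in unitmx -> cmx Q (X *m Y) = cmx Q X *m cmx Q Y.
Proof. by move=> Qu; rewrite !cmxE !mulmxA mulmxKV. Qed.

Lemma cmxD Q a X Y : cmx Q (a *: X + Y) = a *: cmx Q X + cmx Q Y.
Proof. by rewrite !cmxE mulmxDr mulmxDl -scalemxAr -scalemxAl. Qed.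

Lemma cmxZ Q a X : cmx Q (a *: X) = a *: cmx Q X.
Proof. by rewrite !cmxE -scalemxAr -scalemxAl. Qed.

Lemma cmxB Q X Y : cmx Q (X - Y) = cmx Q X - cmx Q Y.
Proof. by rewrite !cmxE mulmxBr mulmxBl. Qed.

Lemma cmxV Q X : Q \in unitmx -> cmx Q (cmx (invmx Q) X) = X.
Proof. by move=> Qu; rewrite !cmxE invmxK !mulmxA mulmxV // mul1mx mulmxK. Qed.

Lemma cmx_bracket Q X Y : Q \in unitmx ->
  cmx Q (mxbracket X Y) = mxbracket (cmx Q X) (cmx Q Y).
Proof. by move=> Qu; rewrite /mxbracket cmxB !cmxM. Qed.

Lemma cmx_inj Q : Q \in unitmx -> injective (cmx Q).
Proof.
move=> Qu; apply: (can_inj (g := cmx (invmx Q))) => X.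
by rewrite !cmxE invmxK !mulmxA mulVmx // mul1mx mulmxKV.
Qed.

Lemma mxtrace_cmx Q X : Q \in unitmx -> \tr (cmx Q X) = \tr X.
Proof. by move=> Qu; rewrite !cmxE mxtrace_mulC mulmxA mulVmx // mul1mx. Qed.

(** An equality of spaces rather than an inclusion: it allows explicit traceless diagonal matrices
    to be pulled back into [h] as test elements. *)
Definition diagonalizes (h : {vspace 'M[R]_n}) Q : Prop :=
  Q \in unitmx /\
  forall M, (M \in h) = (\tr M == 0) && is_diag_mx (cmx Q M).

Lemma is_diag_mx_comm X Y : is_diag_mx X -> is_diag_mx Y -> X *m Y = Y *m X.
Proof. by move=> /diag_mxP[d ->] /diag_mxP[d' ->]; exact: diag_mxC. Qed.

(** Commuting diagonalizable matrices have a common eigenbasis. Conversely, a traceless matrix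
    diagonal in that basis centralizes [h], so it lies in [h] by self-normalization. *)
Lemma split_cartan_diagonalizes h : split_cartan h ->
  exists Q, diagonalizes h Q.
Proof.
case=> hsl habel hnorm hdiag.
have : codiagonalizable (vbasis h).
  apply/codiagonalizableP; split=> [X Y Xh Yh|X Xh].
    by apply/eqP; rewrite -subr_eq0; apply/eqP/habel; exact: vbasis_mem.
  have [s ss sE] := hdiag _ (vbasis_mem Xh).
  exact: ad_diagonalizable_diagonalizable ss sE.
move=> [Q Qu /allP Qdiag]; exists Q; split=> // M.
have diagh X : X \in h -> is_diag_mx (cmx Q X).
  rewrite -(span_basis (vbasisP h)).
  apply: (span_ind (Q := fun X => is_diag_mx (cmx Q X))).
  - by rewrite cmx0; exact: mx0_is_diag.
  - move=> a {}X Y /is_diag_mxP dX /is_diag_mxP dY; apply/is_diag_mxP=> i j ij.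
    by rewrite cmxD mxE [X in X + _]mxE dX // dY // mulr0 addr0.
  by move=> {}X /Qdiag; rewrite cmxE -conjumx.
apply/idP/idP => [Mh|/andP[trM dM]].
  by rewrite diagh // andbT -mem_slv (subvP hsl).
apply: hnorm => [|H Hh]; first by rewrite mem_slv.
suff -> : mxbracket H M = 0 by rewrite mem0v.
apply: (cmx_inj Qu); rewrite cmx_bracket // /mxbracket.
by rewrite (is_diag_mx_comm (diagh _ Hh) dM) subrr cmx0.
Qed.

(** * Roots and root vectors in a diagonalizing basis *)

Section Diagonalized.
Variables (h : {vspace 'M[R]_n}) (Q : 'M[R]_n).
Hypothesis hQ : diagonalizes h Q.

(** The classical root eps_i - eps_j of sl(n), read in the eigenbasis given by [Q]. *)
Definition root_diff (i j : 'I_n) (H : subvs_of h) : R^o :=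
  cmx Q (vsval H) i i - cmx Q (vsval H) j j.

Lemma root_diff_is_linear i j : linear (root_diff i j).
Proof.
move=> a H H'; rewrite /root_diff linearP cmxD !mxE /GRing.scale /=.
by ring.
Qed.

HB.instance Definition _ i j := GRing.isLinear.Build R (subvs_of h) R^o _
  (root_diff i j) (root_diff_is_linear i j).

Definition root_ij i j : dual h := linfun (root_diff i j).

Lemma root_ijE i j (H : subvs_of h) : root_ij i j H = root_diff i j H.
Proof. exact: lfunE. Qed.

Lemma bracket_diag_entry H X i j : is_diag_mx H ->
  mxbracket H X i j = (H i i - H j j) * X i j.
Proof.
move=> /diag_mxP[d ->]; rewrite /mxbracket mul_diag_mx mul_mx_diag !mxE.
by rewrite !eqxx !mulr1n; ring.
Qed.

(** Entrywise, the root equation says that each nonzero entry [(i, j)] forces [al] to be eps_i -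
    eps_j. Distinct off-diagonal positions give distinct forms, so only one entry survives. *)
Lemma root_vector_entries (al : dual h) X :
  al != 0 -> root_vector al X ->
  exists i j c, [/\ i != j, c != 0 & cmx Q X = c *: delta_mx i j].
Proof.
case: hQ => Qu hE al0 [Xsl X0 alX].
have entry (M : 'M[R]_n) (Mh : M \in h) i j :
    (cmx Q M i i - cmx Q M j j) * cmx Q X i j = al (vsproj h M) * cmx Q X i j.
  have := alX (vsproj h M); rewrite vsprojK //.
  move/(congr1 (cmx Q)); rewrite cmx_bracket // cmxZ => /matrixP/(_ i j).
  rewrite bracket_diag_entry; last by move: Mh; rewrite hE => /andP[].
  by rewrite [in RHS]mxE.
(* A traceless diagonal matrix detecting index [t]: the scalar part cancels in differences of
   diagonal entries. *)
pose T t : 'M[R]_n := n%:R *: delta_mx t t - 1%:M.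
have Th t : cmx (invmx Q) (T t) \in h.
  rewrite hE cmxV // mxtrace_cmx ?unitmx_inv //.
  rewrite mxtraceD raddfN /= mxtraceZ mxtrace1 mxtrace_delta eqxx mulr1 subrr.
  rewrite eqxx /=; apply/is_diag_mxP=> i j ij; rewrite !mxE.
  have -> : (i == j) = false by apply/eqP => e; rewrite e eqxx in ij.
  case: (eqVneq i t) => [it|]; last by rewrite mulr0 subrr.
  case: (eqVneq j t) => [jt|]; last by rewrite mulr0 subrr.
  by rewrite it jt eqxx in ij.
have TE t i : T t i i = n%:R * (i == t)%:R - 1.
  by rewrite !mxE eqxx andbb.
have : cmx Q X != 0.
  apply: contraNneq X0 => cX; apply/eqP/(cmx_inj Qu).
  by rewrite cX cmx0.
move/matrix0Pn => [i [j Xij]]; exists i, j, (cmx Q X i j).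
have ij : i != j.
  apply: contraNneq al0 => eij; apply/eqP/lfunP=> H; rewrite zero_lfunE.
  move: Xij; rewrite -eij => Xii; have := entry _ (subvsP H) i i.
  rewrite subrr mul0r vsvalK => /esym/eqP.
  by rewrite mulf_eq0 (negPf Xii) orbF => /eqP.
split=> //; apply/matrixP=> k l; rewrite !mxE.
have [Xkl|Xkl] := eqVneq (cmx Q X k l) 0.
  have [[ki lj]|] := pselect (k = i /\ l = j).
    by rewrite ki lj in Xkl; rewrite Xkl eqxx in Xij.
  rewrite Xkl; case: (eqVneq k i) => [ki|]; case: (eqVneq l j) => [lj|];
    by rewrite ?mulr0 // => -[].
(* Two nonzero entries carry the same root. Taking [t] to be [i] and then [j] identifies their
   positions. *)
have al_eq t : (i == t)%:R - (j == t)%:R = (k == t)%:R - (l == t)%:R :> R.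
  have e1 := entry _ (Th t) i j; have e2 := entry _ (Th t) k l.
  move/mulIf : e1 => /(_ Xij); move/mulIf : e2 => /(_ Xkl) <-.
  rewrite !cmxV // !TE => e.
  apply: (mulfI (_ : n%:R != 0 :> R)); first by rewrite pnatr_eq0.
  by move: e; lra.
have ki : k = i.
  have := al_eq i; rewrite eqxx eq_sym (negPf ij) subr0.
  case: (eqVneq k i) => // _; case: (l == i) => /eqP.
    by rewrite sub0r -subr_eq0 opprK -natrD pnatr_eq0.
  by rewrite subrr oner_eq0.
have lj : l = j.
  have := al_eq j; rewrite eqxx (negPf ij) ki (negPf ij) !sub0r => /oppr_inj.
  by case: (eqVneq l j) => // _ /eqP; rewrite oner_eq0.
by rewrite ki lj !eqxx mulr1.
Qed.

(* H counts source indices: A being abelian, no index is both the row of an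
   entry of A and the column of another one. *)
Lemma positive_abelian_grading (P : set (dual h)) A :
  positive_roots P -> positive_abelian P A ->
  exists2 H, H \in slv R n & forall X, X \in A -> mxbracket H X = X.
Proof.
case: hQ => Qu hE [Proot _ _ _] [[s As sP] Aabel].
have sE X : X \in s ->
    exists i j c, [/\ i != j, c != 0 & cmx Q X = c *: delta_mx i j].
  by move=> /sP[al /Proot[al0 _]]; exact: root_vector_entries.
pose src i := `[< exists X j c, [/\ X \in s, c != 0, i != j &
                                   cmx Q X = c *: delta_mx i j] >].
pose D : 'M[R]_n := diag_mx (\row_i (src i)%:R).
(* The scalar correction makes the trace zero and does not affect brackets. *)
pose H := cmx (invmx Q) (D - (\tr D / n%:R)%:M).
exists H.
  rewrite mem_slv mxtrace_cmx ?unitmx_inv // mxtraceD raddfN /= mxtrace_scalar.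
  by rewrite -[_ *+ n]mulr_natr divfK ?pnatr_eq0 // subrr.
rewrite {}As in Aabel *.
apply: (span_ind (Q := fun X => mxbracket H X = X)).
- exact: mxbracket0r.
- by move=> a X Y hX hY; rewrite mxbracketDr hX hY.
move=> X Xs; have [i [j [c [ij c0 XE]]]] := sE _ Xs.
have srci : src i by apply/asboolP; exists X, j, c.
(* If [j] were the row of another entry [(j, k)], the commutator would have a nonzero entry at
   [(i, k)]. When [k] is [i], the reversed product sits at [(j, j)] and cannot cancel it. *)
have srcj : src j = false.
  apply/negbTE/asboolPn => -[Y [k [d [Ys d0 jk YE]]]].
  have := Aabel _ _ (memv_span Xs) (memv_span Ys).
  move/(congr1 (cmx Q)); rewrite cmx_bracket // XE YE /mxbracket.
  rewrite -!scalemxAl -!scalemxAr !scalerA mul_delta_mx mul_delta_mx_cond.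
  move/matrixP/(_ i k); rewrite cmx0 !mxE !eqxx /=.
  case: eqP => [->|_] /=; last first.
    by rewrite mulr0n mxE mulr0 subr0 mulr1 => /eqP; rewrite mulf_eq0 (negPf c0) (negPf d0).
  rewrite mulr1n !mxE (negPf ij) /= mulr0 subr0 mulr1 => /eqP.
  by rewrite mulf_eq0 (negPf c0) (negPf d0).
apply: (cmx_inj Qu); rewrite cmx_bracket // XE cmxV //.
apply/matrixP=> k l; rewrite /mxbracket mulmxBl mulmxBr mul_scalar_mx.
rewrite mul_mx_scalar mul_diag_mx mul_mx_diag !mxE.
case: (eqVneq k i) => [->|_]; case: (eqVneq l j) => [->|_];
  by rewrite ?srci ?srcj /=; ring.
Qed.

Definition unit_ij i j := cmx (invmx Q) (delta_mx i j).

Lemma unit_ij_bracket i j k : i != k ->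
  mxbracket (unit_ij i j) (unit_ij j k) = unit_ij i k.
Proof.
case: hQ => Qu _ ik; rewrite /unit_ij -cmx_bracket ?unitmx_inv //; congr cmx.
by rewrite /mxbracket mul_delta_mx mul_delta_mx_0 ?subr0 // eq_sym.
Qed.

Lemma unit_ij_comm i j k l : j != k -> l != i ->
  mxbracket (unit_ij i j) (unit_ij k l) = 0.
Proof.
case: hQ => Qu _ jk li; rewrite /unit_ij -cmx_bracket ?unitmx_inv //.
by rewrite /mxbracket !mul_delta_mx_0 // subr0 cmx0.
Qed.

Lemma root_vector_unit_ij i j : i != j -> root_vector (root_ij i j) (unit_ij i j).
Proof.
case: hQ => Qu hE ij; split.
- by rewrite mem_slv mxtrace_cmx ?unitmx_inv // -mem_slv delta_slv.
- apply/eqP=> /(congr1 (cmx Q)); rewrite cmxV // cmx0.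
  by move=> /matrixP/(_ i j)/eqP; rewrite !mxE !eqxx oner_eq0.
move=> H; apply: (cmx_inj Qu); rewrite cmx_bracket // cmxZ cmxV //.
have := subvsP H; rewrite hE => /andP[_ dH].
apply/matrixP=> k l; rewrite bracket_diag_entry // root_ijE /root_diff !mxE.
by case: (eqVneq k i) => [->|_]; case: (eqVneq l j) => [->|_]; rewrite ?mulr0.
Qed.

Lemma is_root_ij i j : i != j -> is_root (root_ij i j).
Proof.
move=> ij; split; last by exists (unit_ij i j); exact: root_vector_unit_ij.
case: hQ => Qu hE.
(* The coroot, on which the root takes the value 2. *)
pose M := cmx (invmx Q) (delta_mx i i - delta_mx j j).
have Mh : M \in h.
  rewrite hE mxtrace_cmx ?unitmx_inv // mxtraceD raddfN /= !mxtrace_delta !eqxx.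
  rewrite subrr eqxx cmxV //; apply/is_diag_mxP=> k l kl; rewrite !mxE.
  have kl' t : (k == t) && (l == t) = false.
    by apply/negP => /andP[/eqP a /eqP b]; rewrite a b eqxx in kl.
  by rewrite !kl' subrr.
apply/eqP=> /lfunP/(_ (vsproj h M)); rewrite root_ijE zero_lfunE /root_diff.
rewrite vsprojK // cmxV // !mxE !eqxx (negPf ij) [j == i]eq_sym (negPf ij) /=.
by move/eqP; rewrite subr0 sub0r opprK -natrD pnatr_eq0.
Qed.

Lemma root_ijD i j k : root_ij i j + root_ij j k = root_ij i k.
Proof. by apply/lfunP=> H; rewrite add_lfunE !root_ijE /root_diff addrA subrK. Qed.

Lemma root_ijN i j : - root_ij i j = root_ij j i.
Proof. by apply/lfunP=> H; rewrite opp_lfunE !root_ijE /root_diff opprB. Qed.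

(** Positivity of eps_i - eps_j is a total order on indices: totality comes from the choice between
    a root and its opposite, transitivity from closure under sums. Sorting the indices gives [t]. *)
Lemma positive_roots_order (P : set (dual h)) : positive_roots P ->
  exists2 t : 'I_n -> 'I_n, injective t &
    forall i j : 'I_n, (i < j)%N -> P (root_ij (t i) (t j)).
Proof.
case=> _ Ptot Pasym Padd.
(* The diagonal is added by hand, since sorting needs a reflexive relation and [root_ij i i] is
   zero, hence not a root. *)
pose r i j := (i == j) || `[< P (root_ij i j) >].
have rtot : total r.
  move=> i j; rewrite /r; case: (eqVneq i j) => //= ij.
  have [/asboolP->//|] := Ptot _ (is_root_ij ij).
  by rewrite root_ijN => /asboolP ->; rewrite !orbT.
have rtr : transitive r.
  move=> j i k; rewrite /r; case: (eqVneq i j) => [->//|ij /=] /asboolP Pij.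
  case: (eqVneq j k) => [<- _|jk /=]; first by rewrite orbC; apply/orP; left; apply/asboolP.
  move=> /asboolP Pjk; case: (eqVneq i k) => //= ik.
  by apply/asboolP; rewrite -(root_ijD i j k); apply: Padd => //; rewrite root_ijD; exact: is_root_ij.
pose s := sort r (enum 'I_n).
have ssz : size s = n by rewrite size_sort size_enum_ord.
have sun : uniq s by rewrite sort_uniq enum_uniq.
have ssort : sorted r s by apply: sort_sorted.
exists (fun i => nth ord0 s i).
  move=> i j /eqP; rewrite nth_uniq ?ssz ?ltn_ord // => /eqP; exact: val_inj.
move=> i j ij.
have := sorted_ltn_nth rtr ord0 ssort.
move=> /(_ (i : nat) (j : nat)); rewrite !inE ssz => /(_ (ltn_ord _) (ltn_ord _) ij) /orP[|/asboolP//].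
by rewrite nth_uniq ?ssz ?ltn_ord // => /eqP e; rewrite e ltnn in ij.
Qed.

End Diagonalized.

(** Puts an arbitrary choice of positive roots in the standard form of strictly upper triangular
    matrix units; the rank arguments use only these relations. *)
Lemma positive_matrix_units (h : {vspace 'M[R]_n}) (P : set (dual h)) :
  split_cartan h -> positive_roots P ->
  exists E : 'I_n -> 'I_n -> 'M[R]_n,
  [/\ forall i j : 'I_n, (i < j)%N -> exists2 al, P al & root_vector al (E i j),
      forall i j k, i != k -> mxbracket (E i j) (E j k) = E i k
    & forall i j k l, j != k -> l != i -> mxbracket (E i j) (E k l) = 0].
Proof.
move=> /split_cartan_diagonalizes[Q hQ] Ppos.
have [t tinj tP] := positive_roots_order hQ Ppos.
exists (fun i j => unit_ij Q (t i) (t j)); split.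
- move=> i j ij; exists (root_ij h Q (t i) (t j)); first exact: tP.
  apply: root_vector_unit_ij => //; rewrite (inj_eq tinj) -val_eqE /=.
  by rewrite ltn_eqF.
- by move=> i j k ik; apply: (unit_ij_bracket hQ); rewrite (inj_eq tinj).
by move=> i j k l jk li; apply: (unit_ij_comm hQ); rewrite (inj_eq tinj).
Qed.

End SplitCartan.

(** * Isotropy and rank *)

Section Simplicity.
Variables (R : realType) (n' : nat).
Let n := n'.+1.
Implicit Types X Y : 'M[R]_n.

Lemma delta_mul_delta X (i j k l : 'I_n) :
  delta_mx i j *m X *m delta_mx k l = X j k *: delta_mx i l.
Proof.
rewrite -(mul_delta_mx (0 : 'I_1) i j) -(mul_delta_mx (0 : 'I_1) k l).
rewrite !mulmxA -[_ *m X]mulmxA -rowE -[_ *m row j X *m _]mulmxA -colE.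
rewrite -[delta_mx i l](mul_delta_mx (0 : 'I_1)) scalemxAl; congr (_ *m _).
by apply/matrixP=> a b; rewrite mxE big_ord1 !mxE !ord1 mulrC.
Qed.

Variable J : 'M[R]_n -> Prop.
Hypothesis Jlin : forall a X Y, J X -> J Y -> J (a *: X + Y).
Hypothesis Jbr : forall X Y, X \in slv R n -> J Y -> J (mxbracket X Y).

(** With E the unit at [(k, l)], E squared is zero, so [E, [E, X]] = -2 E X E, which is -2 [X l k]
    times E. *)
Lemma ideal_offdiag_delta X (k l : 'I_n) :
  J X -> k != l -> X l k != 0 -> J (delta_mx k l).
Proof.
move=> JX kl Xlk; have J0 : J 0.
  by rewrite -(subrr X) -scaleN1r addrC; apply: Jlin.
have JB := Jbr (delta_slv R kl) (Jbr (delta_slv R kl) JX).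
rewrite -[delta_mx k l]addr0 -[delta_mx k l]scale1r.
suff -> : 1 *: (delta_mx k l : 'M[R]_n) = (- 2%:R * X l k)^-1 *:
    mxbracket (delta_mx k l) (mxbracket (delta_mx k l) X) by exact: Jlin.
rewrite /mxbracket mulmxBr mulmxBl !mulmxA mul_delta_mx_0 1?eq_sym //.
rewrite mul0mx delta_mul_delta -[X *m _ *m _]mulmxA mul_delta_mx_0 1?eq_sym //.
rewrite mulmx0 sub0r subr0 -opprD -mulr2n.
rewrite -[_ *: _ *+ 2]scaler_nat -scaleNr !scalerA.
by rewrite -mulrA mulVf // mulf_neq0 // oppr_eq0 pnatr_eq0.
Qed.

(** Brackets with [X] produce one off-diagonal unit in the ideal; further brackets carry it to every
    off-diagonal position and then to differences of diagonal units. *)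
Lemma slv_simple X : X \in slv R n -> X != 0 -> J X ->
  forall Y, Y \in slv R n -> J Y.
Proof.
move=> Xsl X0 JX.
have J0 : J 0.
  by rewrite -(subrr X) -scaleN1r addrC; apply: Jlin.
have JZ a Y : J Y -> J (a *: Y) by move=> JY; rewrite -[_ *: _]addr0; apply: Jlin.
have JD Y Z : J Y -> J Z -> J (Y + Z) by rewrite -{2}[Y]scale1r; apply: Jlin.
have [k [l [kl Jkl]]] : exists k l : 'I_n, k != l /\ J (delta_mx k l).
  have [dX|] := boolP (is_diag_mx X); last first.
    rewrite /is_diag_mx => /forallPn[l /forallPn[k]]; rewrite negb_imply.
    move=> /andP[lk Xlk]; exists k, l; have kl : k != l by rewrite eq_sym.
    by split=> //; apply: ideal_offdiag_delta JX _ _.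
  (* A diagonal matrix with equal entries is scalar, and a traceless scalar matrix is zero. *)
  have [i [j Xij]] : exists i j, X i i != X j j.
    have [//|nX] := pselect (exists i j, X i i != X j j).
    have Xc i : X i i = X 0 0.
      by apply/eqP/negPn/negP => Xi; apply: nX; exists i, 0.
    case/eqP: X0; suff XE : X = (X 0 0)%:M.
      move: Xsl; rewrite mem_slv XE mxtrace_scalar mulrn_eq0 /= => /eqP ->.
      by rewrite raddf0.
    apply/matrixP=> i j; rewrite [RHS]mxE.
    have [->|ij] := eqVneq i j; first by rewrite mulr1n.
    by move/is_diag_mxP: dX => ->.
  have ij : i != j by apply: contraNneq Xij => ->.
  exists i, j; split=> //.
  have JB := Jbr (delta_slv R ij) JX.
  suff -> : delta_mx i j =
      (X j j - X i i)^-1 *: mxbracket (delta_mx i j) X by exact: JZ.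
  apply/matrixP=> a b; rewrite mxbracketC [RHS]mxE [X in _ * X]mxE.
  rewrite bracket_diag_entry // mxE; case: eqP => [->|] /=; last by rewrite mulr0 oppr0 mulr0.
  case: eqP => [->|] /=; last by rewrite mulr0 oppr0 mulr0.
  by rewrite mulr1 opprB mulVf // subr_eq0 eq_sym.
have row a b c : a != b -> J (delta_mx a b) -> a != c -> J (delta_mx a c).
  move=> ab Jab ac; have [<-//|bc] := eqVneq b c.
  have := JZ (-1) _ (Jbr (delta_slv R bc) Jab).
  rewrite scaleN1r -mxbracketC /mxbracket mul_delta_mx mul_delta_mx_0 ?subr0 //.
  by rewrite eq_sym.
have col a b c : a != b -> J (delta_mx a b) -> c != b -> J (delta_mx c b).
  move=> ab Jab cb; have [<-//|ac] := eqVneq a c.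
  have := Jbr (delta_slv R (_ : c != a)) Jab; rewrite eq_sym ac => /(_ isT).
  by rewrite /mxbracket mul_delta_mx mul_delta_mx_0 ?subr0 // eq_sym.
have Joff i j : i != j -> J (delta_mx i j).
  move=> ij; have [il|il] := eqVneq i l; last first.
    by apply: (row _ l) => //; apply: (col k).
  have [jk|jk] := eqVneq j k; last first.
    apply: (col k) => //; first by rewrite eq_sym.
    by apply: (row _ l) => //; rewrite eq_sym.
  (* The transposed position [(l, k)] escapes the row and column moves, but the double bracket with
     [delta_mx l k] reaches it. *)
  apply: (ideal_offdiag_delta Jkl) => //.
  by rewrite il jk mxE !eqxx oner_eq0.
have Jdiag i : J (delta_mx i i - delta_mx 0 0).
  have [->|i0] := eqVneq i 0; first by rewrite subrr.
  have := Jbr (delta_slv R i0) (Joff 0 i _); rewrite eq_sym i0 => /(_ isT).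
  by rewrite /mxbracket !mul_delta_mx.
have Jsum (I : finType) (F : I -> 'M[R]_n) :
    (forall i, J (F i)) -> J (\sum_i F i).
  by move=> JF; elim/big_ind: _.
move=> Y; rewrite mem_slv => /eqP trY.
(* Taking diagonal units relative to position 0 costs only the trace of [Y], which is zero. *)
have -> : Y = \sum_i (Y i i *: (delta_mx i i - delta_mx 0 0) +
    \sum_j (if i == j then 0 else Y i j *: delta_mx i j)).
  rewrite [LHS]matrix_sum_delta big_split /=.
  under [X in _ = X + _]eq_bigr do rewrite scalerBr.
  rewrite sumrB -scaler_suml -/(\tr Y) trY scale0r subr0 -big_split /=.
  apply: eq_bigr => i _; rewrite (bigD1 i) //=; congr (_ + _).
  rewrite [RHS](bigD1 i) //= eqxx add0r; apply: eq_bigr => j.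
  by rewrite eq_sym => /negPf ->.
apply: (Jsum) => i; apply: JD; first exact: JZ.
apply: Jsum => j; case: eqP => [//|/eqP ij]; apply: JZ; exact: Joff.
Qed.

End Simplicity.

Lemma open_base (R : realType) (m : nat) (Om : set (J1 R m)) :
  open Om -> open (base Om).
Proof.
rewrite !openE => Omo _ [[z p] Oj <-] /=.
have [[/= A B] [Az Bp] AB] := Omo _ Oj.
apply: filterS Az => x Ax; exists (x, p) => //; apply: AB; split=> //=.
exact: nbhs_singleton.
Qed.

(** * Evaluation of the symmetry algebra at a point *)

Section SymmetryAlgebra.
Variables (R : realType) (m n' : nat).
Let n := n'.+1.
Variables (Om : set (J1 R m)) (f : J1 R m -> 'rV[R]_m).
Variable phi : 'M[R]_n -> vfield R m.
Hypothesis symOm : sl_is_symmetry_algebra Om f phi.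
Implicit Types (X Y : 'M[R]_n) (A B : {vspace 'M[R]_n}) (z : J0 R m).
Let U := base Om.

Lemma sym_lin a X Y z : U z -> X \in slv R n -> Y \in slv R n ->
  phi (a *: X + Y) z = a *: phi X z + phi Y z.
Proof. by case: symOm => _ lin _ _ _ Uz Xs Ys; apply: lin => //; rewrite inE. Qed.

Lemma sym_bracket X Y z : U z -> X \in slv R n -> Y \in slv R n ->
  phi (mxbracket X Y) z = bracket (phi X) (phi Y) z.
Proof. by case: symOm => _ _ br _ _ Uz Xs Ys; apply: br => //; rewrite inE. Qed.

Lemma sym0 z : U z -> phi 0 z = 0.
Proof.
move=> Uz; have := sym_lin 1 Uz (mem0v _) (mem0v (slv R n)).
by rewrite scaler0 addr0 scale1r => /eqP; rewrite -subr_eq subrr eq_sym => /eqP.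
Qed.

Lemma symZ a X z : U z -> X \in slv R n -> phi (a *: X) z = a *: phi X z.
Proof.
by move=> Uz Xs; have := sym_lin a Uz Xs (mem0v _); rewrite addr0 sym0 // addr0.
Qed.

Lemma symB X Y z : U z -> X \in slv R n -> Y \in slv R n ->
  phi (X - Y) z = phi X z - phi Y z.
Proof.
by move=> Uz Xs Ys; rewrite addrC -scaleN1r sym_lin // scaleN1r addrC.
Qed.

Lemma sym_sum (I : Type) (r : seq I) (c : I -> R) (F : I -> 'M[R]_n) z :
  U z -> (forall i, F i \in slv R n) ->
  phi (\sum_(i <- r) c i *: F i) z = \sum_(i <- r) c i *: phi (F i) z.
Proof.
move=> Uz Fs; elim: r => [|i r IHr]; first by rewrite !big_nil sym0.
rewrite !big_cons sym_lin ?IHr //.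
by apply: memv_suml => j _; apply: memvZ.
Qed.

Lemma sym_nonzero X : X \in slv R n -> X != 0 -> exists2 z, U z & phi X z != 0.
Proof.
case: symOm => _ _ _ inj _ Xs X0; apply: contrapT => nz.
case/eqP: X0; apply: inj => // z; rewrite inE => Uz.
by apply/eqP/negPn/negP => pz; apply: nz; exists z.
Qed.

(** Both derivatives in the bracket are taken in the zero direction. *)
Lemma isotropy_bracket X Y z : U z -> X \in slv R n -> Y \in slv R n ->
  phi X z = 0 -> phi Y z = 0 -> phi (mxbracket X Y) z = 0.
Proof.
by move=> Uz Xs Ys Xz Yz; rewrite sym_bracket // /bracket Xz Yz !derive0 subrr.
Qed.

(* [X - X0, Y - Y0] = [X, Y] lies in the isotropy algebra of z. *)
Lemma sym_bracket_eq0 X Y X0 Y0 z : U z ->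
  X \in slv R n -> Y \in slv R n -> X0 \in slv R n -> Y0 \in slv R n ->
  phi X z = phi X0 z -> phi Y z = phi Y0 z ->
  mxbracket X Y0 = 0 -> mxbracket X0 Y = 0 -> mxbracket X0 Y0 = 0 ->
  phi (mxbracket X Y) z = 0.
Proof.
move=> Uz Xs Ys X0s Y0s XX0 YY0 e1 e2 e3.
have -> : mxbracket X Y = mxbracket (X - X0) (Y - Y0).
  rewrite [X - X0]addrC [Y - Y0]addrC -[- X0]scaleN1r -[- Y0]scaleN1r
    mxbracketDl !mxbracketDr.
  by rewrite e1 e2 e3 !(scaler0, add0r).
by apply: isotropy_bracket; rewrite ?memvB // symB // ?XX0 ?YY0 subrr.
Qed.

(** The row space is the space of values at [z] of fields from [A], which frees the rank from the
    basis chosen in its definition. *)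
Lemma row_phi_vbasis A z (v : 'rV[R]_(1 + m)) : U z -> (A <= slv R n)%VS ->
  (v <= \matrix_(i < \dim A) (phi (vbasis A)`_i z : 'rV[R]_(1 + m)))%MS <->
  exists2 X, X \in A & phi X z = v.
Proof.
move=> Uz Asl; set M := \matrix_i _.
have bA i : (vbasis A)`_i \in slv R n.
  have [iA|iA] := ltnP i (size (vbasis A)); last by rewrite nth_default ?mem0v.
  by rewrite (subvP Asl) // vbasis_mem // mem_nth.
split=> [/submxP[u ->]|[X XA <-]].
  exists (\sum_i u 0 i *: (vbasis A)`_i).
    apply: memv_suml => i _; apply: memvZ; apply: vbasis_mem.
    by rewrite mem_nth // size_tuple.
  rewrite sym_sum // mulmx_sum_row; apply: eq_bigr => i _; congr (_ *: _).
  by rewrite rowK.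
rewrite (coord_vbasis XA) sym_sum //; apply: summx_sub => i _.
by apply: scalemx_sub; have := row_sub i M; rewrite rowK.
Qed.

Lemma free_rank_at A z (s : seq 'M[R]_n) : U z -> (A <= slv R n)%VS ->
  {subset s <= A} -> free [seq phi X z : 'rV[R]_(1 + m) | X <- s] ->
  (size s <= rank_at phi A z)%N.
Proof.
move=> Uz Asl sA fs; pose F := \matrix_(i < size s) (phi s`_i z : 'rV[R]_(1 + m)).
suff rF : row_free F.
  move/eqP: rF => <-; apply/mxrankS/row_subP => i; rewrite rowK.
  by apply/row_phi_vbasis => //; exists s`_i => //; apply/sA/mem_nth.
rewrite -kermx_eq0; apply/eqP/row_matrixP => i; rewrite row0.
set u := row i _; have uF : u *m F = 0 by rewrite -row_mul mulmx_ker row0.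
clearbody u; apply/rowP => j; rewrite mxE.
have /freeP fu : free (map_tuple (fun X => phi X z : 'rV[R]_(1 + m)) (in_tuple s)).
  by [].
apply: (fu (fun k => u 0 k)); rewrite -[RHS]uF mulmx_sum_row.
by apply: eq_bigr => k _; rewrite rowK (nth_map 0).
Qed.

Lemma rank_at_onto A z v : U z -> (A <= slv R n)%VS ->
  rank_at phi A z = m.+1 -> exists2 X, X \in A & phi X z = v.
Proof.
move=> Uz Asl rA; apply/row_phi_vbasis => //; apply: submx_full.
by apply/eqP; exact: rA.
Qed.

(* If A is abelian and transitive at z, then ad(b) acts as a derivation killing
   X for b in A, so the ideal generated by X stays in the isotropy algebra. *)
Lemma abelian_full_rank_isotropy A z : U z -> (A <= slv R n)%VS ->
  (forall X Y, X \in A -> Y \in A -> mxbracket X Y = 0) ->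
  rank_at phi A z = m.+1 -> forall X, X \in A -> phi X z = 0 -> X = 0.
Proof.
move=> Uz Asl Aabel rA X XA Xz.
pose ad := foldr (@mxbracket R n).
have ad_slv Y L : Y \in slv R n -> ad Y L \in slv R n.
  by case: L => //= a L _; exact: mxbracket_slv.
have ad_lin a Y Z L : ad (a *: Y + Z) L = a *: ad Y L + ad Z L.
  by elim: L => //= T L ->; rewrite mxbracketDr.
have ad0 L : ad 0 L = 0 by elim: L => //= T L ->; exact: mxbracket0r.
have Xsl := subvP Asl _ XA.
pose iso k := forall L, size L = k -> {subset L <= slv R n} ->
  phi (ad X L) z = 0.
(* Jacobi pushes [b] inwards. Each step leaves a bracket of length [k] in which [Y] became
   [mxbracket b Y], covered by [iso k]; once [b] meets [X], commutativity of [A] ends the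
   descent. *)
have isob k b pre L : iso k -> b \in A -> (size pre + size L = k)%N ->
    {subset pre <= slv R n} -> {subset L <= slv R n} ->
    phi (ad (mxbracket b (ad X L)) pre) z = 0.
  move=> isok bA; elim: L pre => [|Y L IHL] pre sz presl Lsl /=.
    by rewrite Aabel // ad0 sym0.
  have Ysl : Y \in slv R n by apply: Lsl; rewrite mem_head.
  have L'sl : {subset L <= slv R n} by move=> Z ZL; apply: Lsl; rewrite inE ZL orbT.
  rewrite mxbracket_jacobi -[X in X + _]scale1r ad_lin sym_lin //;
    try by apply/ad_slv/mxbracket_slv.
  have -> : ad (mxbracket (mxbracket b Y) (ad X L)) pre =
            ad X (pre ++ mxbracket b Y :: L) by rewrite /ad foldr_cat.
  have -> : ad (mxbracket Y (mxbracket b (ad X L))) pre =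
            ad (mxbracket b (ad X L)) (rcons pre Y) by rewrite /ad foldr_rcons.
  rewrite isok ?scaler0 ?add0r; last 2 first.
  - by rewrite size_cat.
  - move=> Z; rewrite mem_cat inE => /orP[/presl//|/orP[/eqP->|/L'sl//]].
    exact: mxbracket_slv.
  apply: IHL => //; first by rewrite size_rcons addSn -addnS.
  by move=> Z; rewrite mem_rcons inE => /orP[/eqP->//|/presl].
have isoP k : iso k.
  elim: k => [|k IHk]; first by move=> [].
  move=> [//|Y L] /= [sz] Lsl.
  have Ysl : Y \in slv R n by apply: Lsl; rewrite mem_head.
  have L'sl : {subset L <= slv R n} by move=> Z ZL; apply: Lsl; rewrite inE ZL orbT.
  (* By transitivity some [b] in [A] agrees with [Y] at [z]. Then [Y - b] is in the isotropy
     algebra, and the contribution of [b] is handled by [isob]. *)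
  have [b bA bz] := rank_at_onto (phi Y z) Uz Asl rA.
  have bsl := subvP Asl _ bA.
  have -> : mxbracket Y (ad X L) =
      1 *: mxbracket (Y - b) (ad X L) + mxbracket b (ad X L).
    by rewrite -mxbracketDl scale1r subrK.
  rewrite sym_lin ?mxbracket_slv // scale1r (isob k b [::]) // addr0.
  apply: isotropy_bracket; rewrite ?memvB ?ad_slv //; last exact: IHk.
  by rewrite symB // bz subrr.
apply/eqP/negPn/negP => X0.
(* Vanishing of all iterated brackets at [z] defines an ideal. Containing [X], it would be all of
   sl(n), against transitivity of [A] at [z]. *)
have : forall Y, Y \in slv R n -> (fun Y => forall L, {subset L <= slv R n} ->
    Y \in slv R n /\ phi (ad Y L) z = 0) Y.
  apply: (slv_simple _ _ Xsl X0).
  - move=> a Y Z HY HZ L Ls; have [Ys Y0] := HY _ Ls; have [Zs Z0] := HZ _ Ls.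
    by rewrite memvD ?memvZ // ad_lin sym_lin ?ad_slv // Y0 Z0 scaler0 addr0.
  - move=> Y Z Ys HZ L Ls; split; first exact: mxbracket_slv.
    have -> : ad (mxbracket Y Z) L = ad Z (rcons L Y) by rewrite /ad foldr_rcons.
    have [|_ //] := HZ (rcons L Y).
    by move=> T; rewrite mem_rcons inE => /orP[/eqP->//|/Ls].
  by move=> L Ls; split=> //; exact: isoP.
move=> iso_all; have [Y YA] := rank_at_onto (const_mx 1) Uz Asl rA.
have [//|_ /= ->] := iso_all Y (subvP Asl _ YA) [::].
move/rowP/(_ 0); rewrite !mxE => /eqP; rewrite eq_sym; exact/negP/oner_neq0.
Qed.

(** By the preceding lemma evaluation at [z] is injective on [A], so dimension and rank agree. *)
Lemma abelian_full_rank_dim A z : U z -> (A <= slv R n)%VS ->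
  (forall X Y, X \in A -> Y \in A -> mxbracket X Y = 0) ->
  rank_at phi A z = m.+1 -> \dim A = m.+1.
Proof.
move=> Uz Asl Aabel rA; rewrite -rA; apply/esym/eqP.
rewrite -/(row_free _) -kermx_eq0; apply/eqP/row_matrixP => i; rewrite row0.
set u := row i _; set F := \matrix_i _ in u *.
have uF : u *m F = 0 by rewrite -row_mul mulmx_ker row0.
clearbody u; have bA j : (vbasis A)`_j \in A.
  have [jA|jA] := ltnP j (size (vbasis A)); last by rewrite nth_default ?mem0v.
  by rewrite vbasis_mem // mem_nth.
have : \sum_j u 0 j *: (vbasis A)`_j = 0.
  apply: (abelian_full_rank_isotropy Uz Asl Aabel rA).
    by apply: memv_suml => j _; exact: memvZ.
  rewrite sym_sum //; last by move=> j; apply: (subvP Asl).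
  rewrite -[RHS]uF mulmx_sum_row; apply: eq_bigr => j _; congr (_ *: _).
  by rewrite rowK.
have /freeP fA := basis_free (vbasisP A).
move=> /(fA (fun j => u 0 j)) u0; apply/rowP => j; by rewrite u0 mxE.
Qed.

(** * Maximal positive abelian subalgebras and their geometric rank *)

Section Ranks.
Variables (h : {vspace 'M[R]_n}) (P : set (dual h)).

Lemma positive_abelian_slv A : positive_abelian P A -> (A <= slv R n)%VS.
Proof.
by move=> [[s -> sP] _]; apply/span_subvP => X /sP[al _ []].
Qed.

Lemma positive_abelian_span (s : seq 'M[R]_n) :
  (forall X, X \in s -> exists2 al, P al & root_vector al X) ->
  (forall X Y, X \in s -> Y \in s -> mxbracket X Y = 0) ->
  positive_abelian P (span s).
Proof.
move=> sP sabel; split; first by exists s.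
move=> X Y Xs Ys; move: X Xs.
apply: (span_ind (Q := fun X => mxbracket X Y = 0)).
- by rewrite mxbracketC mxbracket0r oppr0.
- by move=> a Z T HZ HT; rewrite mxbracketDl HZ HT scaler0 addr0.
move=> X Xs; move: Y Ys; apply: (span_ind (Q := fun Y => mxbracket X Y = 0)).
- exact: mxbracket0r.
- by move=> a Z T HZ HT; rewrite mxbracketDr HZ HT scaler0 addr0.
by move=> Y; exact: sabel.
Qed.

Lemma maximal_positive_abelian_extend A : positive_abelian P A ->
  exists2 B, maximal_positive_abelian P B & (A <= B)%VS.
Proof.
have [k] := ubnP (\dim {:'M[R]_n} - \dim A); elim: k A => // k IHk A dA PA.
have [Amax|Amax] := pselect (maximal_positive_abelian P A).
  by exists A; rewrite ?subvv.
have [B [PB AB nBA]] : exists B, [/\ positive_abelian P B, (A <= B)%VS & B <> A].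
  apply: contrapT => nB; apply: Amax; split=> // B PB AB.
  by apply: contrapT => nBA; apply: nB; exists B.
have ltAB : (\dim A < \dim B)%N.
  rewrite ltn_neqAle dimvS // andbT; apply/negP => e; apply/nBA/esym/eqP.
  by rewrite eqEdim AB (eqP e) leqnn.
have [|C Cmax BC] := IHk B _ PB; last by exists C => //; exact: subv_trans BC.
rewrite -ltnS; apply: leq_trans dA; rewrite ltnS ltn_sub2l //.
by apply: leq_trans ltAB _; exact/dimvS/subvf.
Qed.

Lemma geometric_rank_le A : (geometric_rank U phi A <= m.+1)%N.
Proof. by apply/bigmax_leqP => r _; rewrite -ltnS. Qed.

Lemma rank_at_geometric_rank A z : U z ->
  (rank_at phi A z <= geometric_rank U phi A)%N.
Proof.
move=> Uz; have rm : (rank_at phi A z < m.+2)%N by rewrite ltnS rank_leq_col.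
rewrite /geometric_rank (bigD1 (Ordinal rm)) ?leq_maxl //=.
by apply/asboolP; exists z.
Qed.

(** Starts from an extension of the zero subalgebra and passes to larger geometric rank; this stops
    because the rank is at most [m.+1]. *)
Lemma maximal_rank_abelian_exists :
  exists A, maximal_rank_abelian U phi P A.
Proof.
have P0 : positive_abelian P (span [::]) by exact: positive_abelian_span.
have [A0 A0max _] := maximal_positive_abelian_extend P0.
have [k] := ubnP (m.+1 - geometric_rank U phi A0).
elim: k A0 A0max => // k IHk A Amax dA.
have [|nA] := pselect (maximal_rank_abelian U phi P A); first by exists A.
have [B [Bmax AB]] : exists B, maximal_positive_abelian P B /\
    (geometric_rank U phi A < geometric_rank U phi B)%N.
  apply: contrapT => nB; apply: nA; split=> // B Bmax.
  by rewrite leqNgt; apply/negP => AB; apply: nB; exists B.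
apply: (IHk B Bmax); rewrite -ltnS; apply: leq_trans dA; rewrite ltnS.
by rewrite ltn_sub2l //; apply: leq_trans AB (geometric_rank_le _).
Qed.

(** One point suffices: the span of [s] extends to a maximal [B] of full rank at [z], and [A] has
    geometric rank at least that of [B]. *)
Lemma maximal_rank_abelian_full (s : seq 'M[R]_n) z : U z ->
  (forall X, X \in s -> exists2 al, P al & root_vector al X) ->
  (forall X Y, X \in s -> Y \in s -> mxbracket X Y = 0) ->
  free [seq phi X z : 'rV[R]_(1 + m) | X <- s] -> size s = m.+1 ->
  forall A, maximal_rank_abelian U phi P A -> geometric_rank U phi A = m.+1.
Proof.
move=> Uz sP sabel fs sz A [Amax AB].
have [B Bmax sB] := maximal_positive_abelian_extend (positive_abelian_span sP sabel).
apply/eqP; rewrite eqn_leq geometric_rank_le.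
apply: leq_trans (AB _ Bmax); apply: leq_trans (rank_at_geometric_rank B Uz).
rewrite -sz; apply: free_rank_at => //.
  by case: Bmax => /positive_abelian_slv.
by move=> X Xs; apply: (subvP sB); exact: memv_span.
Qed.

End Ranks.
End SymmetryAlgebra.

(** * Independent commuting positive root vectors for sl(3) and sl(4) *)

Section FullRank.
Variables (R : realType) (m : nat).
Variables (Om : set (J1 R m)) (f : J1 R m -> 'rV[R]_m).
Let U := base Om.

Lemma root_vector_slv n (h : {vspace 'M[R]_n}) (P : set (dual h)) X :
  (exists2 al, P al & root_vector al X) -> X \in slv R n.
Proof. by move=> [al _ []]. Qed.

Lemma mxbracket_scale_eq0 n (X Z : 'M[R]_n) a :
  mxbracket X Z = 0 -> mxbracket X (a *: Z) = 0.
Proof.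
by move=> XZ; rewrite -[a *: Z]addr0 mxbracketDr XZ mxbracket0r scaler0 addr0.
Qed.

Lemma mxbracket_eq0C n (X Y : 'M[R]_n) : mxbracket X Y = 0 -> mxbracket Y X = 0.
Proof. by rewrite mxbracketC => /eqP; rewrite oppr_eq0 => /eqP. Qed.

(** At a point where [Z] is nonzero, [X] and [Y] cannot both be multiples of [Z], since [Z] is their
    bracket. One of them, together with [Z], gives the list. *)
Lemma sl3_full_rank (phi : 'M[R]_3 -> vfield R m) (h : {vspace 'M[R]_3})
    (P : set (dual h)) :
  sl_is_symmetry_algebra Om f phi -> split_cartan h -> positive_roots P ->
  exists z (s : seq 'M[R]_3), [/\ U z, size s = 2%N,
    forall X, X \in s -> exists2 al, P al & root_vector al X,
    forall X Y, X \in s -> Y \in s -> mxbracket X Y = 0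
  & free [seq phi X z : 'rV[R]_(1 + m) | X <- s]].
Proof.
move=> symOm hC hP; have [E [Er Ebr E0]] := positive_matrix_units hC hP.
pose o0 := @Ordinal 3 0 isT; pose o1 := @Ordinal 3 1 isT.
pose o2 := @Ordinal 3 2 isT.
have Zr := Er o0 o2 isT; have Xr := Er o0 o1 isT; have Yr := Er o1 o2 isT.
set Z := E o0 o2 in Zr; set X := E o0 o1 in Xr; set Y := E o1 o2 in Yr.
have [[Zs Xs] Ys] := (root_vector_slv Zr, root_vector_slv Xr, root_vector_slv Yr).
have XY : mxbracket X Y = Z by exact: Ebr.
have XZ : mxbracket X Z = 0 by exact: E0.
have ZY : mxbracket Z Y = 0 by exact: E0.
have Z0 : Z != 0 by case: Zr => al _ [].
have [z Uz Zz] := sym_nonzero symOm Zs Z0.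
suff [W [Wr WZ Wz]] : exists W, [/\ exists2 al, P al & root_vector al W,
    mxbracket W Z = 0 & (phi W z : 'rV[R]_(1 + m)) \notin span [:: phi Z z]].
  exists z, [:: W; Z]; split=> //.
  - by move=> T; rewrite !inE => /orP[] /eqP ->.
  - move=> S T; rewrite !inE => /orP[] /eqP -> /orP[] /eqP ->;
      rewrite ?mxbracketxx //.
    exact: mxbracket_eq0C.
  by rewrite /= free_cons Wz /= seq1_free.
have [Xz|Xz] := boolP ((phi X z : 'rV[R]_(1 + m)) \in span [:: phi Z z]); last by exists X.
exists Y; split=> //; first exact: mxbracket_eq0C.
apply/negP => Yz; case/negP: Zz; apply/eqP.
move: Xz Yz; rewrite !span_seq1 => /vlineP[a Xa] /vlineP[b Yb].
rewrite -XY; apply: (sym_bracket_eq0 symOm (X0 := a *: Z) (Y0 := b *: Z)) => //.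
- exact: memvZ.
- exact: memvZ.
- by rewrite (symZ symOm).
- by rewrite (symZ symOm).
- exact: mxbracket_scale_eq0.
- exact/mxbracket_eq0C/mxbracket_scale_eq0/mxbracket_eq0C.
apply/mxbracket_scale_eq0/mxbracket_eq0C/mxbracket_scale_eq0; exact: mxbracketxx.
Qed.

(** The Heisenberg argument is used twice: through index 1 to find [W] independent of [Z], then
    through index 2 to find [V] independent of both. *)
Lemma sl4_full_rank (phi : 'M[R]_4 -> vfield R m) (h : {vspace 'M[R]_4})
    (P : set (dual h)) :
  sl_is_symmetry_algebra Om f phi -> split_cartan h -> positive_roots P ->
  exists z (s : seq 'M[R]_4), [/\ U z, size s = 3%N,
    forall X, X \in s -> exists2 al, P al & root_vector al X,
    forall X Y, X \in s -> Y \in s -> mxbracket X Y = 0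
  & free [seq phi X z : 'rV[R]_(1 + m) | X <- s]].
Proof.
move=> symOm hC hP; have [E [Er Ebr E0]] := positive_matrix_units hC hP.
pose o0 := @Ordinal 4 0 isT; pose o1 := @Ordinal 4 1 isT.
pose o2 := @Ordinal 4 2 isT; pose o3 := @Ordinal 4 3 isT.
have Zr := Er o0 o3 isT; set Z := E o0 o3 in Zr.
have Z0 : Z != 0 by case: Zr => al _ [].
have Zs := root_vector_slv Zr.
have [z Uz Zz] := sym_nonzero symOm Zs Z0.
(* The last two clauses make [W] commute with both candidates for [V], whichever is chosen later. *)
have [W [Wr WZ Wz W02 W23]] : exists W, [/\ exists2 al, P al & root_vector al W,
    mxbracket W Z = 0, (phi W z : 'rV[R]_(1 + m)) \notin span [:: phi Z z],
    mxbracket W (E o0 o2) = 0 & mxbracket W (E o2 o3) = 0].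
  have [Xz|Xz] := boolP ((phi (E o0 o1) z : 'rV[R]_(1 + m)) \in span [:: phi Z z]).
    exists (E o1 o3); split; [exact: Er | exact: E0 | | exact: E0 | exact: E0].
    apply/negP => Yz; case/negP: Zz; apply/eqP.
    have Xs := root_vector_slv (Er o0 o1 isT).
    have Ys := root_vector_slv (Er o1 o3 isT).
    move: Xz Yz; rewrite !span_seq1 => /vlineP[a Xa] /vlineP[b Yb].
    rewrite -[Z](Ebr o0 o1 o3) //.
    apply: (sym_bracket_eq0 symOm (X0 := a *: Z) (Y0 := b *: Z)) => //;
      rewrite ?memvZ ?(symZ symOm) //.
    + by apply: mxbracket_scale_eq0; exact: E0.
    + by apply/mxbracket_eq0C/mxbracket_scale_eq0; exact: E0.
    + by apply/mxbracket_eq0C/mxbracket_scale_eq0/mxbracket_eq0C/mxbracket_scale_eq0/mxbracketxx.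
  by exists (E o0 o1); split=> //; [exact: Er | exact: E0 | exact: E0 | exact: E0].
have Ws := root_vector_slv Wr.
suff [V [Vr VZ VW Vz]] : exists V, [/\ exists2 al, P al & root_vector al V,
    mxbracket V Z = 0, mxbracket V W = 0
    & (phi V z : 'rV[R]_(1 + m)) \notin span [:: phi W z; phi Z z]].
  exists z, [:: V; W; Z]; split=> //.
  - by move=> T; rewrite !inE => /or3P[] /eqP ->.
  - by move=> S T; rewrite !inE => /or3P[] /eqP -> /or3P[] /eqP ->;
      rewrite ?mxbracketxx // mxbracket_eq0C.
  by rewrite /= !free_cons Vz /= Wz /= nil_free andbT span_nil memv0.
have [Xz|Xz] := boolP ((phi (E o0 o2) z : 'rV[R]_(1 + m)) \in
    span [:: phi W z; phi Z z]); last first.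
  exists (E o0 o2); split=> //; [exact: Er | exact: E0 | exact: mxbracket_eq0C].
exists (E o2 o3); split; [exact: Er | exact: E0 | exact: mxbracket_eq0C |].
apply/negP => Yz; case/negP: Zz; apply/eqP.
have Xs := root_vector_slv (Er o0 o2 isT).
have Ys := root_vector_slv (Er o2 o3 isT).
have inspan (v : 'rV[R]_(1 + m)) : v \in span [:: phi W z; phi Z z] ->
    exists a b, v = phi (a *: W + b *: Z) z.
  rewrite span_cons span_seq1 => /memv_addP[v1 /vlineP[a ->]] [v2 /vlineP[b ->]] ->.
  by exists a, b; rewrite (sym_lin symOm) ?memvZ // (symZ symOm).
have [a [b Xa]] := inspan _ Xz; have [c [d Yc]] := inspan _ Yz.
have comb (X : 'M[R]_4) r r' : mxbracket X W = 0 -> mxbracket X Z = 0 ->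
    mxbracket X (r *: W + r' *: Z) = 0.
  by move=> XW XZ; rewrite mxbracketDr XW mxbracket_scale_eq0 // scaler0 addr0.
rewrite -[Z](Ebr o0 o2 o3) //.
apply: (sym_bracket_eq0 symOm (X0 := a *: W + b *: Z) (Y0 := c *: W + d *: Z)) => //;
  rewrite ?memvD ?memvZ //.
- exact: comb (mxbracket_eq0C _) (E0 _ _ _ _ _ _).
- exact: mxbracket_eq0C (comb _ a b (mxbracket_eq0C W23) (E0 _ _ _ _ _ _)).
exact: comb (mxbracket_eq0C (comb _ a b (mxbracketxx W) WZ))
            (mxbracket_eq0C (comb _ a b (mxbracket_eq0C WZ) (mxbracketxx Z))).
Qed.

End FullRank.

(** * Functions of class C^k *)

Section ClassC.
Variables (R : realType) (V : normedModType R).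
Implicit Types (D : set V) (k : nat).

Lemma class_C_continuous (W : normedModType R) k D (f : V -> W) x :
  class_C k D f -> D x -> {for x, continuous f}.
Proof. by case: k => [|k] [cf _] Dx; exact: cf. Qed.

Lemma class_C_derivable (W : normedModType R) k D (f : V -> W) x v :
  class_C k.+1 D f -> D x -> derivable f x v.
Proof. by move=> [_ df] Dx; exact: (df v).1. Qed.

Lemma class_C_derive (W : normedModType R) k D (f : V -> W) v :
  class_C k.+1 D f -> class_C k D (fun x => 'D_v f x).
Proof. by move=> [_ df]; exact: (df v).2. Qed.

Lemma class_CW (W : normedModType R) k D (f : V -> W) :
  class_C k.+1 D f -> class_C k D f.
Proof.
elim: k f => [|k IHk] f [cf df]; first by split.
by split=> // v; split; [exact: (df v).1 | apply: IHk; exact: (df v).2].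
Qed.

Lemma class_C_sub (W : normedModType R) k D D' (f : V -> W) :
  D' `<=` D -> class_C k D f -> class_C k D' f.
Proof.
move=> sD; elim: k f => [|k IHk] f [cf df]; split; try by move=> x /sD; exact: cf.
  by [].
move=> v; split; first by move=> x /sD; exact: (df v).1.
exact/IHk/(df v).2.
Qed.

(** On an open [D], equality holds near each point, so it passes to all iterated derivatives. *)
Lemma class_C_eq (W : normedModType R) k D (f g : V -> W) : open D ->
  (forall x, D x -> f x = g x) -> class_C k D f -> class_C k D g.
Proof.
move=> oD; elim: k f g => [|k IHk] f g fg [cf df].
  split=> // x Dx; have nD := open_nbhs_nbhs (conj oD Dx).
  rewrite /continuous_at /prop_for -(fg _ Dx); apply: cvg_trans (cf _ Dx).
  by apply: near_eq_cvg; apply: filterS nD => y; exact: fg.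
have nfg x : D x -> {near x, f =1 g}.
  by move=> Dx; apply: filterS (open_nbhs_nbhs (conj oD Dx)) => y; exact: fg.
split=> [x Dx|v].
  rewrite /prop_for /continuous_at -(fg _ Dx); apply: cvg_trans (cf _ Dx).
  by apply: near_eq_cvg; exact: nfg.
split=> [x Dx|].
  by apply: near_eq_derivable (nfg _ Dx) _; exact: (df v).1.
apply: IHk (df v).2 => x Dx; apply: near_eq_derive; exact: nfg.
Qed.

Lemma class_C_cst (W : normedModType R) k D (a : W) : class_C k D (fun=> a).
Proof.
elim: k a => [|k IHk] a; first by split=> // x _; exact: cst_continuous.
split=> [x _|v]; first exact: cst_continuous.
split=> [x _|]; first exact: derivable_cst.
by under eq_fun do rewrite derive_cst; exact: IHk.
Qed.

Lemma class_CD (W : normedModType R) k D (f g : V -> W) : open D ->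
  class_C k D f -> class_C k D g -> class_C k D (fun x => f x + g x).
Proof.
move=> oD; elim: k f g => [|k IHk] f g [cf df] [cg dg].
  by split=> // x Dx; apply: continuousD; [exact: cf | exact: cg].
split=> [x Dx|v]; first by apply: continuousD; [exact: cf | exact: cg].
split=> [x Dx|]; first by apply: derivableD; [exact: (df v).1|exact: (dg v).1].
apply: class_C_eq (IHk _ _ (df v).2 (dg v).2) => // x Dx.
by rewrite -deriveD //; [exact: (df v).1|exact: (dg v).1].
Qed.

Lemma class_CM k D (f g : V -> R) : open D ->
  class_C k D f -> class_C k D g -> class_C k D (fun x => f x * g x).
Proof.
move=> oD; elim: k f g => [|k IHk] f g cf cg.
  split=> // x Dx.
  by apply: (@continuousM R V f g x); [exact: cf.1 | exact: cg.1].
split=> [x Dx|v].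
  by apply: (@continuousM R V f g x); [exact: cf.1 | exact: cg.1].
split=> [x Dx|].
  by apply: (@derivableM R V f g); apply: class_C_derivable Dx; eassumption.
have /class_C_eq : forall x, D x ->
    f x * 'D_v g x + g x * 'D_v f x = 'D_v (fun x => f x * g x) x.
  move=> x Dx; rewrite -/(f * g) deriveM //; apply: class_C_derivable Dx; eassumption.
apply=> //; apply: class_CD => //; apply: IHk; try exact: class_CW.
  by apply: class_C_derive.
by apply: class_C_derive.
Qed.

Lemma class_CV k D (f : V -> R) : open D -> (forall x, D x -> f x != 0) ->
  class_C k D f -> class_C k D (fun x => (f x)^-1).
Proof.
move=> oD f0; elim: k => [|k IHk] cf.
  split=> // x Dx; apply: continuousV; [exact: f0 | exact: cf.1].
split=> [x Dx|v]; first by apply: continuousV; [exact: f0 | exact: cf.1].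
split=> [x Dx|].
  by apply: derivableV; [exact: f0|apply: class_C_derivable Dx; eassumption].
have /class_C_eq : forall x, D x ->
    (-1 * ((f x)^-1 * (f x)^-1)) * 'D_v f x = 'D_v (fun x => (f x)^-1) x.
  move=> x Dx; rewrite deriveV ?f0 //; last by apply: class_C_derivable Dx; eassumption.
  by rewrite mulN1r -invfM -expr2.
apply=> //; have cfi := IHk (class_CW cf).
apply: class_CM => //; last exact: class_C_derive.
by apply: class_CM => //; [exact: class_C_cst | exact: class_CM].
Qed.

Lemma class_C_sum (W : normedModType R) k D (I : Type) (r : seq I)
    (F : I -> V -> W) : open D ->
  (forall i, class_C k D (F i)) -> class_C k D (fun x => \sum_(i <- r) F i x).
Proof.
move=> oD cF; elim: r => [|i r IHr].
  by under eq_fun do rewrite big_nil; exact: class_C_cst.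
by under eq_fun do rewrite big_cons; exact: class_CD.
Qed.

Lemma class_C_prod k D (I : Type) (r : seq I) (F : I -> V -> R) : open D ->
  (forall i, class_C k D (F i)) -> class_C k D (fun x => \prod_(i <- r) F i x).
Proof.
move=> oD cF; elim: r => [|i r IHr].
  by under eq_fun do rewrite big_nil; exact: class_C_cst.
by under eq_fun do rewrite big_cons; exact: class_CM.
Qed.

Lemma class_C_det k D p (M : V -> 'M[R]_p) : open D ->
  (forall i j, class_C k D (fun x => M x i j)) ->
  class_C k D (fun x => \det (M x)).
Proof.
move=> oD cM; apply: class_C_sum => // s; apply: class_CM => //.
  exact: class_C_cst.
by apply: class_C_prod.
Qed.

Lemma continuous_mx p q (f : V -> 'M[R]_(p, q)) x :
  (forall i j, {for x, continuous (fun y => f y i j)}) -> {for x, continuous f}.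
Proof.
move=> cf; apply/cvgrPdist_lt => e e0.
have : \forall y \near x, forall ij : 'I_p * 'I_q,
    `|f x ij.1 ij.2 - f y ij.1 ij.2| < e.
  by apply: filter_forall => -[i j]; have /cvgrPdist_lt := cf i j; exact.
apply: filterS => y fy; rewrite /Num.Def.normr /= mx_normrE.
by apply: bigmax_lt => // -[i j] _ /=; rewrite !mxE; exact: (fy (i, j)).
Qed.

Lemma class_C_mxP k D p q (f : V -> 'M[R]_(p, q)) : open D ->
  class_C k D f <-> forall i j, class_C k D (fun x => f x i j).
Proof.
move=> oD; elim: k f => [|k IHk] f.
  split=> [[cf _] i j|cf].
    split=> // x Dx; apply: (@continuous_comp _ _ _ f (fun M => M i j)).
      exact: cf.
    exact: coord_continuous.
  split=> // x Dx; apply: continuous_mx => i j; exact: (class_C_continuous (cf i j)).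
split=> [cf i j|cf].
  have [c0 _] := cf.
  split=> [x Dx|v].
    apply: (@continuous_comp _ _ _ f (fun M => M i j)); first exact: c0.
    exact: coord_continuous.
  split=> [x Dx|].
    by have /derivable_mxP := class_C_derivable (v := v) cf Dx; exact.
  have /IHk/(_ i j) := class_C_derive v cf.
  apply: class_C_eq => // x Dx.
  by rewrite derive_mx ?mxE //; apply: class_C_derivable Dx; exact: cf.
have c0 : class_C 0 D f.
  split=> // x Dx; apply: continuous_mx => i j; exact: (class_C_continuous (cf i j)).
split=> [|v]; first exact: c0.1.
have der x : D x -> derivable f x v.
  by move=> Dx; apply/derivable_mxP => i j; apply: class_C_derivable Dx; exact: cf.
split=> //; apply/IHk => i j; have := class_C_derive v (cf i j).
by apply: class_C_eq => // x Dx; rewrite derive_mx ?mxE //; exact: der.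
Qed.

End ClassC.

(** * Calculus of directional derivatives *)

Section DirectionalDerivatives.
Variables (R : realType) (V : normedModType R).

(** Turns a directional derivative into a one-variable derivative at every parameter of the line, as
    the mean value theorem requires. *)
Lemma is_derive_line_at (W : normedModType R) (f : V -> W) (x v : V) (t : R) :
  derivable f (t *: v + x) v ->
  is_derive t 1 (fun h : R => f (h *: v + x)) ('D_v f (t *: v + x)).
Proof.
have E : (fun h : R => h^-1 *: (f ((h *: 1 + t) *: v + x) - f (t *: v + x))) =
         (fun h : R => h^-1 *: (f (h *: v + (t *: v + x)) - f (t *: v + x))).
  by rewrite funeqE => h; rewrite [_ *: 1]mulr1 scalerDl addrA.
move=> df; apply: DeriveDef; first by move: df; rewrite /derivable /= E.
by rewrite /derive /= E.
Qed.

Lemma is_derive_line (W : normedModType R) (f : V -> W) (x v : V) :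
  derivable f x v -> is_derive (0 : R) 1 (fun h : R => f (h *: v + x)) ('D_v f x).
Proof.
by move=> df; have := @is_derive_line_at W f x v 0; rewrite scale0r add0r; exact.
Qed.

Lemma derive_line (W : normedModType R) (f : V -> W) (x v : V) :
  'D_v f x = 'D_1 (fun h : R => f (h *: v + x)) 0.
Proof.
have E : (fun h : R => h^-1 *: (f ((h *: (1 : R) + 0 : R) *: v + x) - f (0 *: v + x))) =
         (fun h : R => h^-1 *: (f (h *: v + x) - f x)).
  by rewrite funeqE => h; rewrite [_ *: 1]mulr1 addr0 scale0r add0r.
by rewrite /derive /= E.
Qed.

(** Bounding [c] by absolute values treats both signs of [s], and zero, uniformly. *)
Lemma mean_value0 (g dg : R -> R) (s : R) :
  (forall x : R, `|x| <= `|s| -> is_derive x (1 : R) g (dg x)) ->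
  exists2 c, `|c| <= `|s| & g s - g 0 = s * dg c.
Proof.
move=> dg_; have cont (a b : R) : (forall x : R, x \in `[a, b]%R -> `|x| <= `|s|) ->
    {within `[a, b], continuous g}.
  move=> ab; apply: derivable_within_continuous => x /ab /dg_ dgx.
  exact: (@ex_derive _ _ _ _ _ _ _ dgx).
case: (ltgtP 0 s) => s0.
- have sub x : x \in `[0, s]%R -> `|x| <= `|s|.
    by rewrite in_itv /= => /andP[x0 xs]; rewrite !ger0_norm // ltW.
  have [|c cs E] := MVT s0 _ (cont _ _ sub) (df := dg).
    by move=> x xs; apply/dg_/sub; apply: subset_itv_oo_cc xs.
  exists c; first by apply: sub; apply: subset_itv_oo_cc cs.
  by rewrite E subr0 mulrC.
- have sub x : x \in `[s, 0]%R -> `|x| <= `|s|.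
    by rewrite in_itv /= => /andP[sx x0]; rewrite !ler0_norm ?lerN2 // ltW.
  have [|c cs E] := MVT s0 _ (cont _ _ sub) (df := dg).
    by move=> x xs; apply/dg_/sub; apply: subset_itv_oo_cc xs.
  exists c; first by apply: sub; apply: subset_itv_oo_cc cs.
  by rewrite -opprB E sub0r mulrN opprK mulrC.
by exists 0; rewrite ?normr0 // -s0 subrr mul0r.
Qed.

(** The increment is split into a move along [v] followed by one along [u]. The second is evaluated
    by the mean value theorem at a nearby point, and continuity of the derivative along [u] brings
    it back to [z]. *)
Lemma derive_lincomb_scalar (D : set V) (f : V -> R) z a u v : open D -> D z ->
  class_C 1 D f -> 'D_(a *: u + v) f z = a * 'D_u f z + 'D_v f z.
Proof.
move=> oD Dz cf; apply: cvg_lim => //.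
have dv : h^-1 *: (f (h *: v + z) - f z) @[h --> 0^'] --> 'D_v f z.
  exact: class_C_derivable cf Dz.
suff du : h^-1 *: (f ((h * a) *: u + (h *: v + z)) - f (h *: v + z)) @[h --> 0^']
    --> a * 'D_u f z.
  set F := (X in X @ _); have -> : F = (fun h : R => h^-1 *:
      (f ((h * a) *: u + (h *: v + z)) - f (h *: v + z)) +
      h^-1 *: (f (h *: v + z) - f z)).
    rewrite funeqE => h /=.
    by rewrite /F /= -scalerDr subrKA [h *: (_ + v)]scalerDr scalerA addrA.
  exact: cvgD du dv.
apply/cvgrPdist_le => e e0.
pose e1 := e / (`|a| + 1).
have a1 : 0 < `|a| + 1 by rewrite ltr_wpDl.
have e10 : 0 < e1 by rewrite divr_gt0.
have cu : {for z, continuous (fun x => 'D_u f x)}.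
  exact: class_C_continuous (class_C_derive u cf) Dz.
have : \forall x \near z, D x /\ `|'D_u f z - 'D_u f x| <= e1.
  apply: filterI; first exact: open_nbhs_nbhs.
  by move/cvgrPdist_le : cu; exact.
move=> /nbhs_ballP[r /= r0 Br].
(* Bounds the displacement per unit of [h]; the added 1 keeps it positive. *)
pose b := `|a| * `|u| + `|v| + 1.
have b0 : 0 < b by rewrite ltr_wpDl // addr_ge0 // mulr_ge0.
near=> h.
have h0 : h != 0 by near: h; exact: nbhs_dnbhs_neq.
have hr : `|h| < r / b by near: h; apply: dnbhs0_lt; rewrite divr_gt0.
have inB s : `|s| <= `|h * a| -> ball z r (s *: u + (h *: v + z)).
  move=> sh; rewrite -ball_normE /= addrA opprD addrCA subrr addr0 normrN.
  apply: le_lt_trans (ler_normD _ _) _; rewrite !normrZ.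
  move: hr; rewrite ltr_pdivlMr // => /(le_lt_trans _); apply.
  rewrite /b !mulrDr mulr1.
  have : `|s| * `|u| <= `|h| * (`|a| * `|u|).
    by rewrite mulrA -normrM ler_wpM2r.
  have := normr_ge0 h; lra.
have dg (x : R) : `|x| <= `|h * a| -> is_derive x (1 : R)
    (fun s : R => f (s *: u + (h *: v + z))) ('D_u f (x *: u + (h *: v + z))).
  move=> /inB/Br[Dx _]; apply: is_derive_line_at.
  exact: class_C_derivable cf Dx.
have [c /inB/Br[_ cle]] := mean_value0 dg.
rewrite scale0r add0r => ->.
rewrite /GRing.scale /= !mulrA mulVf // mul1r -mulrBr normrM.
apply: le_trans (ler_wpM2l (normr_ge0 _) cle) _.
rewrite /e1 mulrCA ger_pMr // ler_pdivrMr // mul1r; lra.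
Unshelve. all: by end_near. Qed.

Lemma derive_lincomb (D : set V) p q (f : V -> 'M[R]_(p, q)) z a u v :
  open D -> D z -> class_C 1 D f ->
  'D_(a *: u + v) f z = a *: 'D_u f z + 'D_v f z.
Proof.
move=> oD Dz cf; have cfij := (class_C_mxP 1 f oD).1 cf.
have dl : derivable f z (a *: u + v) by exact: class_C_derivable cf Dz.
have du : derivable f z u by exact: class_C_derivable cf Dz.
have dv : derivable f z v by exact: class_C_derivable cf Dz.
rewrite (derive_mx dl) (derive_mx du) (derive_mx dv); apply/matrixP => i j; rewrite !mxE.
exact: derive_lincomb_scalar (cfij i j).
Qed.

Lemma derive_sum_dir (D : set V) p q (f : V -> 'M[R]_(p, q)) z (I : Type)
    (r : seq I) (c : I -> R) (v : I -> V) :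
  open D -> D z -> class_C 1 D f ->
  'D_(\sum_(i <- r) c i *: v i) f z = \sum_(i <- r) c i *: 'D_(v i) f z.
Proof.
move=> oD Dz cf; elim: r => [|i r IHr]; first by rewrite !big_nil derive0.
by rewrite !big_cons (derive_lincomb _ _ _ oD Dz cf) IHr.
Qed.

Lemma is_deriveZfun p q (g : V -> R) (F : V -> 'M[R]_(p, q)) z v dg dF :
  is_derive z v g dg -> is_derive z v F dF ->
  is_derive z v (fun x => g x *: F x) (dg *: F z + g z *: dF).
Proof.
move=> [dg_ <-] [dF_ <-].
have dFij i j : derivable (fun x => F x i j) z v by exact: (derivable_mxP _ _ _).1.
have dm : derivable (fun x => g x *: F x) z v.
  apply/derivable_mxP => i j.
  have -> : (fun x => (g x *: F x) i j) = g * (fun x => F x i j).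
    by apply/funext => x; rewrite mxE.
  exact: derivableM dg_ (dFij i j).
have dij i j : 'D_v (fun x => g x * F x i j) z =
    'D_v g z * F z i j + g z * 'D_v (fun x => F x i j) z.
  by rewrite (deriveM dg_ (dFij i j)) addrC mulrC.
apply: DeriveDef => //; rewrite (derive_mx dm) (derive_mx dF_).
apply/matrixP => i j; rewrite !mxE; under eq_fun do rewrite mxE.
exact: dij.
Qed.

Lemma is_derive_sumZ p q n (g : 'I_n -> V -> R) (F : 'I_n -> V -> 'M[R]_(p, q)) z v :
  (forall i, derivable (g i) z v) -> (forall i, derivable (F i) z v) ->
  is_derive z v (fun x => \sum_i g i x *: F i x)
    (\sum_i ('D_v (g i) z *: F i z + g i z *: 'D_v (F i) z)).
Proof.
move=> dg dF.
have -> : (fun x => \sum_i g i x *: F i x) = \sum_i (fun x => g i x *: F i x).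
  by apply/funext => x; rewrite fct_sumE.
by apply: is_derive_sum => i; apply: is_deriveZfun; exact: derivableP.
Qed.

Lemma is_derive_rsubmx p q1 q2 (F : V -> 'M[R]_(p, q1 + q2)) z v dF :
  is_derive z v F dF -> is_derive z v (fun x => rsubmx (F x)) (rsubmx dF).
Proof.
move=> [dF_ <-].
have d : derivable (fun x => rsubmx (F x)) z v.
  apply/derivable_mxP => i j; under eq_fun do rewrite mxE.
  exact: (derivable_mxP _ _ _).1.
apply: DeriveDef => //; rewrite (derive_mx d) (derive_mx dF_).
apply/matrixP => i j; by rewrite !mxE; under eq_fun do rewrite mxE.
Qed.

Lemma is_derive_lsubmx00 q2 (F : V -> 'rV[R]_(1 + q2)) z v dF :
  is_derive z v F dF ->
  is_derive z v (fun x => lsubmx (F x) 0 0) (lsubmx dF 0 0).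
Proof.
move=> [dF_ <-].
have d : derivable (fun x => lsubmx (F x) 0 0) z v.
  under eq_fun do rewrite mxE; exact: (derivable_mxP _ _ _).1.
apply: DeriveDef => //; rewrite (derive_mx dF_) !mxE.
by under eq_fun do rewrite mxE.
Qed.

End DirectionalDerivatives.

(** * Frames of commuting fields *)

Section Frames.
Variables (R : realType) (m : nat).
Implicit Types (V : set (J0 R m)) (E : 'I_(1 + m) -> vfield R m).

Definition frame_mx E (z : J0 R m) : 'M[R]_(1 + m) :=
  \matrix_(i < 1 + m) (E i z : 'rV[R]_(1 + m)).

Lemma frame_indep E z (c : 'I_(1 + m) -> R) : frame_mx E z \in unitmx ->
  \sum_i c i *: E i z = 0 -> forall i, c i = 0.
Proof.
move=> Mu c0 i; have : (\row_j c j) *m frame_mx E z = 0.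
  rewrite mulmx_sum_row -[RHS]c0; apply: eq_bigr => j _.
  by rewrite rowK mxE.
move/(canRL (mulmxK Mu)); rewrite mul0mx => /rowP/(_ i).
by rewrite !mxE.
Qed.

Lemma frame_unitmx E z :
  (forall c : 'I_(1 + m) -> R, \sum_i c i *: E i z = 0 -> forall i, c i = 0) ->
  frame_mx E z \in unitmx.
Proof.
move=> ind; rewrite -row_free_unit -kermx_eq0; apply/eqP/row_matrixP => i.
rewrite row0; set u := row i _.
have uM : u *m frame_mx E z = 0 by rewrite -row_mul mulmx_ker row0.
clearbody u; apply/rowP => j; rewrite [RHS]mxE; apply: (ind (fun j => u 0 j)).
by rewrite -[RHS]uM mulmx_sum_row; apply: eq_bigr => k _; rewrite rowK.
Qed.

Lemma class_C_frame_det k V E : open V -> (forall i, class_C k V (E i)) ->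
  class_C k V (fun z => \det (frame_mx E z)).
Proof.
move=> oV cE; apply: class_C_det => // i j.
have := (class_C_mxP k (E i : J0 R m -> 'rV[R]_(1 + m)) oV).1 (cE i) 0 j.
by apply: class_C_eq => // x _; rewrite mxE.
Qed.

(* Cramer's rule keeps the coefficients smooth. *)
Lemma frame_coefficients V E (X : vfield R m) : open V ->
  (forall i, smooth V (E i)) -> smooth V X ->
  (forall z, V z -> frame_mx E z \in unitmx) ->
  exists g : 'I_(1 + m) -> J0 R m -> R,
    (forall i, smooth V (g i)) /\
    forall z, V z -> X z = \sum_i g i z *: E i z.
Proof.
move=> oV sE sX Mu; pose M := frame_mx E.
exists (fun i z => ((X z : 'rV[R]_(1 + m)) *m invmx (M z)) 0 i); split=> [i k|z Vz].
  have cM a b : class_C k V (fun z => M z a b).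
    have := (class_C_mxP k (E a : J0 R m -> 'rV[R]_(1 + m)) oV).1 (sE a k) 0 b.
    by apply: class_C_eq => // x _; rewrite mxE.
  have cX b : class_C k V (fun z => (X z : 'rV[R]_(1 + m)) 0 b).
    exact: (class_C_mxP k (X : J0 R m -> 'rV[R]_(1 + m)) oV).1 (sX k) 0 b.
  have cdet : class_C k V (fun z => \det (M z)) by apply: class_C_det.
  have det0 z : V z -> \det (M z) != 0.
    by move=> /Mu; rewrite unitmxE unitfE.
  apply: (@class_C_eq _ _ _ _ _ (fun z => \sum_l (X z : 'rV[R]_(1 + m)) 0 l *
      ((\det (M z))^-1 * ((-1) ^+ (i + l) * \det (row' i (col' l (M z))))))) => //.
    move=> z Vz; rewrite mxE; apply: eq_bigr => l _.
    by rewrite /invmx ifT ?Mu // !mxE.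
  apply: class_C_sum => // l; apply: class_CM => //.
  apply: class_CM => //; first exact: class_CV.
  apply: class_CM => //; first exact: class_C_cst.
  apply: class_C_det => // a b; apply: class_C_eq (cM (lift i a) (lift l b)) => //.
  by move=> x _; rewrite !mxE.
rewrite -[LHS](mulmxKV (Mu _ Vz)) mulmx_sum_row; apply: eq_bigr => i _.
by rewrite rowK.
Qed.

(* [E_j, X] = E_j expands to sum_i E_j(g_i) E_i = E_j, the brackets of the
   commuting E_i contributing nothing. *)
Lemma frame_coefficients_derive V E (X : vfield R m) (g : 'I_(1 + m) -> J0 R m -> R) :
  open V -> (forall i, class_C 1 V (E i)) -> (forall i, class_C 1 V (g i)) ->
  (forall z, V z -> frame_mx E z \in unitmx) ->
  (forall z, V z -> X z = \sum_i g i z *: E i z) ->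
  (forall i j z, V z -> bracket (E i) (E j) z = 0) ->
  (forall j z, V z -> bracket (E j) X z = E j z) ->
  forall i j z, V z -> 'D_(E j z) (g i) z = (i == j)%:R.
Proof.
move=> oV cE cg Mu XE comm brX i j z Vz.
have comm' k l : 'D_(E k z) (E l) z = 'D_(E l z) (E k) z.
  by apply/eqP; rewrite -subr_eq0; apply/eqP; exact: comm.
have nV : \forall x \near z, X x = \sum_i g i x *: E i x.
  by apply: filterS (open_nbhs_nbhs (conj oV Vz)) => x; exact: XE.
have dX : 'D_(E j z) X z =
    \sum_k ('D_(E j z) (g k) z *: E k z + g k z *: 'D_(E j z) (E k) z).
  rewrite (near_eq_derive _ nV).
  apply: (@derive_val _ _ _ _ _ _ _ (is_derive_sumZ _ _)) => k;
    by apply: class_C_derivable Vz.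
have dE : 'D_(X z) (E j) z = \sum_k g k z *: 'D_(E k z) (E j) z.
  by rewrite XE //; exact: derive_sum_dir (cE j).
have := brX j z Vz; rewrite /bracket dX dE big_split /= -addrA -sumrB.
rewrite [X in _ + X]big1 ?addr0 => [|k _]; last by rewrite comm' subrr.
move=> e; apply/eqP; rewrite -subr_eq0; apply/eqP; move: i.
apply: (frame_indep (Mu _ Vz)).
under eq_bigr do rewrite scalerBl.
rewrite sumrB e [X in _ - X](bigD1 j) //= eqxx scale1r big1 ?addr0 ?subrr //.
by move=> k /negPf ->; rewrite scale0r.
Qed.

(** The differential of [F] is the coframe dual to [E]; applied to the expansion of [v] it reads off
    the coefficients. *)
Lemma dir_frame V E (F : J0 R m -> J0 R m) z v : open V -> V z ->
  class_C 1 V F -> (forall i, 'D_(E i z) F z = delta_mx 0 i :> 'rV[R]_(1 + m)) ->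
  frame_mx E z \in unitmx ->
  v = \sum_i ('D_v F z : 'rV[R]_(1 + m)) 0 i *: E i z.
Proof.
move=> oV Vz cF FE Mu.
pose c := (v : 'rV[R]_(1 + m)) *m invmx (frame_mx E z).
have vE : v = \sum_i c 0 i *: E i z.
  rewrite -[LHS](mulmxKV Mu) mulmx_sum_row; apply: eq_bigr => i _.
  by rewrite rowK.
clearbody c; rewrite {1}vE; apply: eq_bigr => i _; congr (_ *: _).
rewrite vE (derive_sum_dir _ _ _ oV Vz cF) summxE (bigD1 i) //= FE !mxE !eqxx.
rewrite mulr1 big1 ?addr0 // => j ji; rewrite FE !mxE eqxx.
by rewrite eq_sym (negPf ji) mulr0.
Qed.

(** The injectivity half of the inverse function theorem: near [z] the map, normalized to have
    identity differential there, distorts differences by at most a factor one half in the maximum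
    norm. *)
Lemma local_injectivity V E (F : J0 R m -> J0 R m) z : open V -> V z ->
  class_C 1 V F -> (forall i, 'D_(E i z) F z = delta_mx 0 i :> 'rV[R]_(1 + m)) ->
  frame_mx E z \in unitmx ->
  exists V' : set (J0 R m),
    [/\ open V', V' `<=` V, V' z & {in V' &, injective F}].
Proof.
move=> oV Vz cF FE Mu.
(* Multiplication by the constant frame matrix at [z] normalizes the differential of [F] to the
   identity. *)
pose f k x := \sum_i (F x : 'rV[R]_(1 + m)) 0 i * (E i z : 'rV[R]_(1 + m)) 0 k.
have cFi i : class_C 1 V (fun x => (F x : 'rV[R]_(1 + m)) 0 i).
  exact: (class_C_mxP 1 (F : J0 R m -> 'rV[R]_(1 + m)) oV).1 cF 0 i.
have cf k : class_C 1 V (f k).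
  apply: (class_C_sum _ (F := fun i x => (F x : 'rV[R]_(1 + m)) 0 i *
    (E i z : 'rV[R]_(1 + m)) 0 k) oV) => i.
  by apply: (class_CM oV (cFi i)); exact: class_C_cst.
pose d l : J0 R m := (delta_mx 0 l : 'rV[R]_(1 + m)).
have df k l : 'D_(d l) (f k) z = (l == k)%:R.
  have dFz : derivable F z (d l) by exact: class_C_derivable cF Vz.
  have dFi i : derivable (fun x => (F x : 'rV[R]_(1 + m)) 0 i) z (d l).
    exact: class_C_derivable (cFi i) Vz.
  have dR : 'D_(d l) (f k) z = \sum_i 'D_(d l) ((fun x => (F x : 'rV[R]_(1 + m)) 0 i) *
                          (fun=> (E i z : 'rV[R]_(1 + m)) 0 k)) z.
    rewrite -derive_sum; last by move=> i; apply: derivableM => //; exact: derivable_cst.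
    by congr derive; apply/funext => x; rewrite fct_sumE.
  rewrite dR.
  transitivity ((d l : 'rV[R]_(1 + m)) 0 k); last by rewrite mxE eqxx eq_sym.
  rewrite [in RHS](dir_frame (d l) oV Vz cF FE Mu) summxE; apply: eq_bigr => i _.
  have dcst : derivable (fun=> (E i z : 'rV[R]_(1 + m)) 0 k) z (d l).
    exact: derivable_cst.
  rewrite (deriveM (dFi i) dcst) derive_cst scaler0 add0r (derive_mx dFz) !mxE.
  exact: mulrC.
(* Deviations below [(2 * N)^-1] in each of [N] terms add up to at most one half. *)
pose N : R := (1 + m)%:R.
have N0 : 0 < N by rewrite ltr0n.
have N2 : 0 < (2 * N)^-1 by rewrite invr_gt0 mulr_gt0.
have near_df : \forall x \near z, forall kl : 'I_(1 + m) * 'I_(1 + m),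
    `|(kl.2 == kl.1)%:R - 'D_(d kl.2) (f kl.1) x| < (2 * N)^-1.
  apply: (@filter_forall _ _ (fun (kl : 'I_(1 + m) * 'I_(1 + m)) (x : J0 R m) =>
    `|(kl.2 == kl.1)%:R - 'D_(d kl.2) (f kl.1) x| < (2 * N)^-1) (nbhs z)).
  move=> -[k l] /=; rewrite -df.
  have /cvgrPdist_lt/(_ _ N2) := class_C_continuous (class_C_derive (d l) (cf k)) Vz.
  exact.
have [r /= r0 Br] :=
  (nbhs_ballP _ _).1 (filterI (open_nbhs_nbhs (conj oV Vz)) near_df).
have r30 : 0 < r / 3 by rewrite divr_gt0.
(* The points [s *: v + y] with [s] between -1 and 1 are within r/3 + 2r/3 of [z], hence in the ball
   of radius [r]. *)
exists (ball z (r / 3)); split.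
- exact: ball_open.
- have r3 : r / 3 <= r by lra.
  by move=> x /(le_ball r3)/Br[].
- exact: ballxx.
move=> x y; rewrite !inE => xB yB Fxy; apply/eqP; rewrite -subr_eq0; apply/eqP.
pose v : 'rV[R]_(1 + m) := x - y.
suff v0 : forall k, v 0 k = 0 by apply/rowP => k; rewrite [LHS]v0 mxE.
have [k _ kmax] := @arg_maxP _ _ _ (0 : 'I_(1 + m)) xpredT (fun k => `|v 0 k|) isT.
suff vk : `|v 0 k| <= 0.
  by move=> l; apply/eqP; rewrite -normr_le0; apply: le_trans vk; exact: kmax.
have inB (s : R) : `|s| <= `|1 : R| -> ball z r (s *: (v : J0 R m) + y).
  rewrite normr1 => s1; move: xB yB; rewrite -!ball_normE /= => xB yB.
  have -> : z - (s *: (v : J0 R m) + y) = (z - y) - s *: (v : J0 R m).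
    by rewrite opprD addrA addrAC.
  apply: le_lt_trans (ler_normB _ _) _; rewrite normrZ.
  have vr : `|v : J0 R m| < r / 3 + r / 3.
    have -> : (v : J0 R m) = (z - y) - (z - x).
      by rewrite /v opprB [in RHS]addrC addrA subrK.
    by apply: le_lt_trans (ler_normB _ _) _; exact: ltrD.
  have : `|s| * `|v : J0 R m| <= `|v : J0 R m|.
    by rewrite ler_piMl.
  lra.
have dg (s : R) : `|s| <= `|1 : R| -> is_derive s (1 : R)
    (fun h : R => f k (h *: (v : J0 R m) + y)) ('D_v (f k) (s *: (v : J0 R m) + y)).
  move=> /inB/Br[Vs _]; apply: is_derive_line_at; exact: class_C_derivable (cf k) Vs.
have [c /inB/Br[Vc near_c]] := mean_value0 dg.
rewrite scale1r scale0r add0r subrK mul1r /f Fxy subrr => /esym.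
set xc := _ + y in Vc near_c *.
have vsum : (v : J0 R m) = \sum_l v 0 l *: d l by exact: row_sum_delta.
have : 'D_(\sum_l v 0 l *: d l) (f k) xc = \sum_l v 0 l * 'D_(d l) (f k) xc.
  elim: (index_enum _) => [|l s IHs]; first by rewrite !big_nil derive0.
  by rewrite !big_cons (derive_lincomb_scalar _ _ _ oV Vc (cf k)) IHs.
rewrite -vsum => ->.
move=> S0.
(* Since [F x = F y], the mean value relation makes the sum with the actual derivatives zero;
   subtracting it leaves the deviations from the identity. *)
have vkE : v 0 k = \sum_l v 0 l * ((l == k)%:R - 'D_(d l) (f k) xc).
  under eq_bigr do rewrite mulrBr.
  rewrite sumrB S0 subr0 (bigD1 k) //= eqxx mulr1 big1 ?addr0 // => l /negPf ->.
  by rewrite mulr0.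
have : `|v 0 k| <= \sum_(l < 1 + m) `|v 0 k| * (2 * N)^-1.
  rewrite {1}vkE; apply: le_trans (ler_norm_sum _ _ _) _.
  apply: ler_sum => l _; rewrite normrM; apply: ler_pM => //; first exact: kmax.
  exact/ltW/(near_c (k, l)).
have N2N : (2 * N)^-1 * (1 + m)%:R = 2^-1 by field; rewrite lt0r_neq0.
rewrite sumr_const card_ord -[_ *+ _]mulr_natr -mulrA N2N.
by move=> vk; have := lerD vk vk; rewrite -splitr gerDl.
Qed.

End Frames.

(** * Prolongations *)

Section Jets.
Variables (R : realType) (m : nat).
Implicit Types (V : set (J0 R m)) (E : 'I_(1 + m) -> vfield R m).
Implicit Types (z d : J0 R m) (p q : 'rV[R]_m).

Definition vert q : J0 R m := row_mx 0 q.

Lemma contact_line (h : R) p q : contact (h *: q + p) = h *: vert q + contact p.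
Proof.
by rewrite /contact /vert scale_row_mx add_row_mx scaler0 add0r.
Qed.

Lemma near_line V z d : open V -> V z -> \forall h \near (0 : R), V (h *: d + z).
Proof.
move=> oV Vz; have [dl _] := is_derive_line (@derivable_id R _ z d).
have /differentiable_continuous cl := (derivable1_diffP _ _).1 dl.
have := cl V; rewrite /= scale0r add0r; apply.
exact: open_nbhs_nbhs.
Qed.

(** Linearity in the direction splits off [h] times the derivative along [vert q]; the product rule
    at 0 then gives the second derivative along a curve with velocity [contact p] and acceleration
    [vert q]. *)
Lemma is_derive_total V (F : J0 R m -> J0 R m) z p q :
  open V -> V z -> class_C 2 V F ->
  is_derive (0 : R) (1 : R)
    (fun h : R => 'D_(contact (h *: q + p)) F (h *: contact p + z))
    ('D_(contact p) (fun x => 'D_(contact p) F x) z + 'D_(vert q) F z).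
Proof.
move=> oV Vz cF; set d := contact p.
have c1 v : class_C 1 V (fun x => 'D_v F x) by exact: class_C_derive.
have dd v : derivable (fun x => 'D_v F x) z d by exact: class_C_derivable (c1 v) Vz.
have dv1 := is_deriveZfun (is_derive_id (0 : R) (1 : R)) (is_derive_line (dd (vert q))).
have dv2 := is_derive_line (dd d).
have := is_deriveD dv1 dv2; rewrite !scale0r !add0r addr0 scale1r.
rewrite [X in is_derive _ _ _ X -> _]addrC.
move=> H; apply: (near_eq_is_derive _ H).
apply: filterS (near_line d oV Vz) => h Vh.
rewrite contact_line -/d (derive_lincomb _ _ _ oV Vh) //.
exact: class_CW.
Qed.

Lemma derive_dep (F : J0 R m -> J0 R m) z v : derivable F z v ->
  'D_v (@dep R m \o F) z = dep ('D_v F z).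
Proof.
by move=> /derivableP dF; have [_] := is_derive_rsubmx (q1 := 1) (q2 := m) dF; exact.
Qed.

Lemma derive_indep (F : J0 R m -> J0 R m) z v : derivable F z v ->
  'D_v (@indep R m \o F) z = indep ('D_v F z).
Proof. by move=> /derivableP dF; have [_] := is_derive_lsubmx00 dF; exact. Qed.

Lemma indep_contact p : indep (contact p) = 1.
Proof. by rewrite /indep /contact row_mxKl mxE. Qed.

Lemma dep_contact p : dep (contact p) = p.
Proof. by rewrite /dep /contact row_mxKr. Qed.

Lemma indepZ (a : R) (u : J0 R m) : indep (a *: u) = a * indep u.
Proof. by rewrite /indep !mxE. Qed.

Lemma depZ (a : R) (u : J0 R m) : dep (a *: u) = a *: dep u.
Proof. by rewrite /dep linearZ. Qed.

Lemma indepD (u v : J0 R m) : indep (u + v) = indep u + indep v.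
Proof. by rewrite /indep !mxE. Qed.

Lemma depD (u v : J0 R m) : dep (u + v) = dep u + dep v.
Proof. by rewrite /dep raddfD. Qed.

Lemma indep_vert q : indep (vert q) = 0.
Proof. by rewrite /indep /vert row_mxKl mxE. Qed.

Lemma dep_vert q : dep (vert q) = q.
Proof. by rewrite /dep /vert row_mxKr. Qed.

Lemma J0_eq (u v : J0 R m) : indep u = indep v -> dep u = dep v -> u = v.
Proof.
move=> iuv duv; rewrite -[u]hsubmxK -[v]hsubmxK; congr row_mx => //.
by apply/matrixP => i j; rewrite !ord1.
Qed.

Lemma eta1E V (X : vfield R m) z p : V z -> class_C 1 V X ->
  eta1 X (z, p) = dep ('D_(contact p) X z) - indep ('D_(contact p) X z) *: p.
Proof.
move=> Vz cX; have dX : derivable X z (contact p) by exact: class_C_derivable cX Vz.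
by rewrite /eta1 /Dx1 /= derive_dep // derive_indep.
Qed.

(** Three terms in [q] occur: plus one from the dependent part, minus one from differentiating the
    factor [p] in [eta1], minus one from the definition of [eta2]. *)
Lemma eta2_linear_part_id V (X : vfield R m) z p q : open V -> V z ->
  class_C 2 V X -> (forall v, 'D_v X z = v) ->
  let Xdd := 'D_(contact p) (fun x => 'D_(contact p) X x) z in
  eta2 X (z, p, q) = dep Xdd - indep Xdd *: p - q.
Proof.
move=> oV Vz cX Xid /=; set d := contact p; set Xdd := 'D_d _ z.
have c1 : class_C 1 V X by exact: class_CW.
rewrite /eta2 /= /Dx1 /= derive_indep; last exact: class_C_derivable c1 Vz.
rewrite Xid indep_contact scale1r; congr (_ - _ : 'rV[R]_m).
rewrite /Dx2 derive_line /=.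
have dF := is_derive_total p q oV Vz cX; rewrite -/d -/Xdd Xid in dF.
have d1 := is_derive_rsubmx (q1 := 1) (q2 := m) dF.
have d2 := is_derive_lsubmx00 dF.
have d3 := is_derive_line (@derivable_id R _ p q); rewrite derive_id in d3.
have d4 := is_deriveB d1 (is_deriveZfun d2 d3).
rewrite -(near_eq_derive (f := fun h : R => rsubmx ('D_(contact (h *: q + p)) X (h *: d + z)) -
   lsubmx ('D_(contact (h *: q + p)) X (h *: d + z)) 0 0 *: (h *: q + p))); last first.
  by apply: filterS (near_line d oV Vz) => h Vh; rewrite (eta1E _ Vh c1).
rewrite (@derive_val _ _ _ _ _ _ _ d4) !scale0r !add0r Xid.
have -> : rsubmx (Xdd + vert q : 'rV[R]_(1 + m)) = dep Xdd + q.
  by rewrite -[LHS]/(dep (Xdd + vert q)) depD dep_vert.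
have -> : lsubmx (Xdd + vert q : 'rV[R]_(1 + m)) 0 0 = indep Xdd.
  by rewrite -[LHS]/(indep (Xdd + vert q)) indepD indep_vert addr0.
have -> : lsubmx (d : 'rV[R]_(1 + m)) 0 0 = 1 by exact: indep_contact.
by rewrite scale1r opprD addrACA subrr addr0.
Qed.

(** Here ['D_d w z] and [s] are the velocity and acceleration of the image curve; the quotient rule
    says that its slope is stationary exactly when they are parallel. *)
Lemma new_q_eq0 V (w : J0 R m -> J0 R m) z p q : open V -> V z ->
  class_C 2 V w ->
  let d := contact p in
  let s := 'D_d (fun x => 'D_d w x) z + 'D_(vert q) w z in
  indep ('D_d w z) != 0 ->
  new_q w (z, p, q) = 0 <-> exists mu : R, s = mu *: 'D_d w z.
Proof.
move=> oV Vz cw d s i0.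
have c1 : class_C 1 V w by exact: class_CW.
have dw x v : V x -> derivable w x v by move=> Vx; exact: class_C_derivable c1 Vx.
rewrite /new_q /= /Dx1 /= derive_indep; last exact: dw.
rewrite -/d; set i := indep _ in i0 *.
have dF := is_derive_total p q oV Vz cw; rewrite -/d -/s in dF.
have d1 := is_derive_rsubmx (q1 := 1) (q2 := m) dF.
have d2 := is_derive_lsubmx00 dF.
have F0 : 'D_(contact (0 *: q + p)) w (0 *: d + z) = 'D_d w z by rewrite !scale0r !add0r.
have d3 : is_derive (0 : R) (1 : R) (fun h : R =>
    (lsubmx ('D_(contact (h *: q + p)) w (h *: d + z)) 0 0)^-1)
    (- i ^- 2 * indep s).
  have i0' : lsubmx ('D_(contact (0 *: q + p)) w (0 *: d + z)) 0 0 != 0 by rewrite F0.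
  apply: DeriveDef.
    by apply: derivableV => //; exact: (@ex_derive _ _ _ _ _ _ _ d2).
  rewrite (deriveV i0' (@ex_derive _ _ _ _ _ _ _ d2)).
  by rewrite (@derive_val _ _ _ _ _ _ _ d2) F0.
have -> : Dx2 (new_p w) (z, p, q) = (- i ^- 2 * indep s) *: dep ('D_d w z) + i^-1 *: dep s.
  have [_ dE] := is_deriveZfun d3 d1; rewrite F0 in dE.
  rewrite -[RHS]dE /Dx2 derive_line; apply: near_eq_derive.
  apply: filterS (near_line d oV Vz) => h Vh /=.
  by rewrite /new_p /Dx1 /= derive_indep ?derive_dep //; exact: dw.
clearbody s; split=> [/eqP|[mu sE]].
  rewrite scaler_eq0 invr_eq0 (negPf i0) /= => /eqP e.
  (* The factor is forced by the independent component. *)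
  exists (indep s / i); apply: J0_eq.
    by rewrite [RHS]indepZ divfK.
  rewrite [RHS]depZ.
  have := congr1 (fun u => i *: u) e; rewrite scaler0 scalerDr !scalerA divff //.
  rewrite scale1r => /eqP; rewrite addrC addr_eq0 => /eqP ->.
  by rewrite -scaleNr; congr (_ *: _); field.
rewrite sE indepZ depZ -/i scalerA -scalerDl.
by rewrite (_ : _ + _ = 0) ?scale0r ?scaler0 //; field.
Qed.

(* Differentiate X = sum_i g_i E_i and v = sum_i (D_v w)_i E_i, using that g and
   w have the same derivative and that g vanishes at z. *)
Lemma frame_euler_field V E (X : vfield R m) (w : J0 R m -> J0 R m)
    (g : 'I_(1 + m) -> J0 R m -> R) z :
  open V -> V z -> (forall i, smooth V (E i)) -> smooth V w ->
  (forall i, smooth V (g i)) ->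
  (forall x, V x -> frame_mx E x \in unitmx) ->
  (forall x, V x -> X x = \sum_i g i x *: E i x) -> (forall i, g i z = 0) ->
  (forall i x, V x -> 'D_(E i x) w x = delta_mx 0 i :> 'rV[R]_(1 + m)) ->
  (forall i j x, V x -> 'D_(E j x) (g i) x = (i == j)%:R) ->
  (forall v, 'D_v X z = v) /\
  forall d, 'D_('D_d (fun x => 'D_d X x) z) w z = - 'D_d (fun x => 'D_d w x) z.
Proof.
move=> oV Vz sE sw sg Mu XE gz wE gE.
have Vn x : V x -> nbhs x V by move=> Vx; exact: open_nbhs_nbhs.
have dg i x v : V x -> derivable (g i) x v.
  by move=> Vx; apply: class_C_derivable (sg i 1%N) Vx.
have dE i x v : V x -> derivable (E i) x v.
  by move=> Vx; apply: class_C_derivable (sE i 1%N) Vx.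
pose c v i x := ('D_v w x : 'rV[R]_(1 + m)) 0 i.
have vE v x : V x -> v = \sum_i c v i x *: E i x.
  move=> Vx; apply: (dir_frame v oV Vx (sw 1%N)); last exact: Mu.
  by move=> i; exact: wE.
have gw v i x : V x -> 'D_v (g i) x = c v i x.
  move=> Vx; rewrite {1}(vE v x Vx).
  have -> : 'D_(\sum_l c v l x *: E l x) (g i) x = \sum_l c v l x * 'D_(E l x) (g i) x.
    elim: (index_enum _) => [|l s IHs]; first by rewrite !big_nil derive0.
    by rewrite !big_cons (derive_lincomb_scalar _ _ _ oV Vx (sg i 1%N)) IHs.
  rewrite (bigD1 i) //= gE // eqxx mulr1 big1 ?addr0 // => l li.
  by rewrite gE // eq_sym (negPf li) mulr0.
have dX v x : V x -> 'D_v X x = v + \sum_i g i x *: 'D_v (E i) x.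
  move=> Vx; have /near_eq_derive -> : \forall y \near x, X y = \sum_i g i y *: E i y.
    by apply: filterS (Vn _ Vx) => y; exact: XE.
  have [_ ->] := is_derive_sumZ (fun i => dg i x v Vx) (fun i => dE i x v Vx).
  rewrite big_split /=; congr (_ + _); rewrite [RHS](vE v x Vx).
  by apply: eq_bigr => i _; rewrite gw.
have Xid v : 'D_v X z = v.
  by rewrite dX // big1 ?addr0 // => i _; rewrite gz scale0r.
split=> // d.
have cc i : class_C 1 V (c d i).
  exact: (class_C_mxP 1 (fun x => 'D_d w x : 'rV[R]_(1 + m)) oV).1
    (class_C_derive d (sw 2%N)) 0 i.
have dcc i : derivable (c d i) z d by exact: class_C_derivable (cc i) Vz.
have dEd i : derivable (fun x => 'D_d (E i) x) z d.
  exact: class_C_derivable (class_C_derive d (sE i 2%N)) Vz.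
have Xdd : 'D_d (fun x => 'D_d X x) z = \sum_i c d i z *: 'D_d (E i) z.
  have /near_eq_derive -> : \forall y \near z,
      'D_d X y = (fun x => d + \sum_i g i x *: 'D_d (E i) x) y.
    by apply: filterS (Vn _ Vz) => y; exact: dX.
  have := is_deriveD (is_derive_cst d z d)
    (is_derive_sumZ (fun i => dg i z d Vz) dEd).
  move=> [_ ->]; rewrite add0r; apply: eq_bigr => i _.
  by rewrite gz scale0r addr0 gw.
have d0 : 0 = \sum_i ('D_d (c d i) z *: E i z + c d i z *: 'D_d (E i) z).
  have [_ <-] := is_derive_sumZ dcc (fun i => dE i z d Vz).
  have dcst : 'D_d (fun=> d) z = 0 :> J0 R m by exact: derive_cst.
  rewrite -{1}dcst; apply: near_eq_derive.
  by apply: filterS (Vn _ Vz) => y Vy; exact: (vE d y Vy).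
have XddE : 'D_d (fun x => 'D_d X x) z = \sum_i (- 'D_d (c d i) z) *: E i z.
  rewrite Xdd; apply/eqP; rewrite -subr_eq0 -sumrB [X in _ == X]d0; apply/eqP.
  by apply: eq_bigr => i _; rewrite scaleNr opprK addrC.
rewrite XddE (derive_sum_dir _ _ _ oV Vz (sw 1%N)).
have dwd : derivable (fun x => 'D_d w x) z d.
  exact: class_C_derivable (class_C_derive d (sw 2%N)) Vz.
apply/rowP => i; rewrite summxE (bigD1 i) //= wE // big1 => [|j ji].
  by rewrite (derive_mx dwd) !mxE !eqxx mulr1 addr0.
by rewrite wE // !mxE eqxx eq_sym (negPf ji) mulr0.
Qed.

End Jets.

(** * Canonical coordinates *)

(** Extracts from the spanning root vectors of [A] a basis consisting of root vectors. *)
Lemma free_subset (K : fieldType) (vT : vectType K) (s : seq vT) :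
  exists s', [/\ {subset s' <= s}, free s' & span s' = span s].
Proof.
elim: s => [|x s [s' [sub fs' ss']]]; first by exists [::]; rewrite nil_free.
have [xs|xs] := boolP (x \in span s').
  exists s'; split=> //; first by move=> y /sub ys; rewrite inE ys orbT.
  by rewrite span_cons -ss'; apply/esym/addv_idPr; rewrite -memvE.
exists (x :: s'); split; last by rewrite !span_cons ss'.
  by move=> y; rewrite !inE => /orP[->//|/sub ->]; rewrite orbT.
by rewrite free_cons xs.
Qed.

Section CanonicalCoordinates.
Variables (R : realType) (m n' : nat).
Let n := n'.+1.
Variables (Om : set (J1 R m)) (f : J1 R m -> 'rV[R]_m).
Variable phi : 'M[R]_n -> vfield R m.
Hypothesis oOm : open Om.
Hypothesis symOm : sl_is_symmetry_algebra Om f phi.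
Variables (h : {vspace 'M[R]_n}) (P : set (dual h)).
Hypothesis hC : split_cartan h.
Hypothesis hP : positive_roots P.
Let U := base Om.

Let oU : open U. Proof. exact: open_base. Qed.

Lemma sym_smooth X : X \in slv R n -> smooth U (phi X).
Proof. by case: symOm => symX _ _ _ _ /symX[]. Qed.

Lemma sym_bracketE X Y Z z : U z -> X \in slv R n -> Y \in slv R n ->
  mxbracket X Y = Z -> bracket (phi X) (phi Y) z = phi Z z.
Proof. by move=> Uz Xs Ys <-; rewrite (sym_bracket symOm). Qed.

(** The grading element with its sign reversed, so that the relation takes the form
    [frame_coefficients_derive] expects. *)
Lemma abelian_grading A : positive_abelian P A ->
  exists2 H, H \in slv R n & forall X, X \in A -> mxbracket X H = X.
Proof.
move=> PA; have [Q hQ] := split_cartan_diagonalizes hC.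
have [H Hs HA] := positive_abelian_grading hQ hP PA.
exists (- H); first by rewrite memvN.
by move=> X /HA {2}<-; rewrite mxbracketC /mxbracket mulNmx mulmxN opprB opprK addrC.
Qed.

(** The coordinates are the coefficients of [phi H] in the frame given by [A]. *)
Lemma canonical_coordinates_exist A z : positive_abelian P A -> U z ->
  rank_at phi A z = m.+1 ->
  exists V w, V z /\ canonical_coordinates U phi P A V w.
Proof.
move=> PA Uz rA; have Asl := positive_abelian_slv PA.
have [[s As sP] Aabel] := PA.
have dA := abelian_full_rank_dim symOm Uz Asl Aabel rA.
have Ainj := abelian_full_rank_isotropy symOm Uz Asl Aabel rA.
have [H Hs HA] := abelian_grading PA.
have [s' [s's fs' ss']] := free_subset s.
have sz : size s' == (1 + m)%N.
  by rewrite add1n -dA As -ss'; apply/eqP/esym; rewrite /dimv; exact/eqP.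
pose e := Tuple sz.
have eA i : tnth e i \in A.
  by rewrite As -ss'; apply: memv_span; exact: mem_tnth.
have es i : tnth e i \in slv R n by apply: (subvP Asl).
pose E i := phi (tnth e i).
have Mz : frame_mx E z \in unitmx.
  apply: frame_unitmx => c c0 i.
  have : \sum_i c i *: tnth e i = 0.
    apply: Ainj; first by apply: memv_suml => j _; exact: memvZ.
    by rewrite (sym_sum symOm).
  under eq_bigr do rewrite (tnth_nth 0); have /freeP fe : free e by [].
  by move=> /(fe c).
(* The open set where the fields remain a frame; it is shrunk further below to make [w]
   injective. *)
pose V := U `&` [set x | \det (frame_mx E x) != 0].
have cdet : class_C 0 U (fun x => \det (frame_mx E x)).
  by apply: class_C_frame_det => // i; exact: sym_smooth.
have oV : open V.
  rewrite openE => x [Ux x0]; apply: filterI; first exact: open_nbhs_nbhs.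
  exact: cvgr_neq0 (class_C_continuous cdet Ux) x0.
have VU : V `<=` U by move=> x [].
have Vz : V z by split=> //; move: Mz; rewrite unitmxE unitfE.
have Mu x : V x -> frame_mx E x \in unitmx.
  by move=> [_ x0]; rewrite unitmxE unitfE.
have sE i : smooth V (E i) by move=> k; apply: class_C_sub VU _; exact: sym_smooth.
have sH : smooth V (phi H) by move=> k; apply: class_C_sub VU _; exact: sym_smooth.
have [g [sg HE]] := frame_coefficients oV sE sH Mu.
have gE i j x : V x -> 'D_(E j x) (g i) x = (i == j)%:R.
  apply: (frame_coefficients_derive oV (fun i => sE i 1%N) (fun i => sg i 1%N) Mu HE).
    move=> k l y /VU Uy; rewrite (sym_bracketE Uy (es k) (es l) (Aabel _ _ (eA k) (eA l))).
    exact: (sym0 symOm).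
  by move=> k y /VU Uy; exact: sym_bracketE Uy (es k) Hs (HA _ (eA k)).
pose w : J0 R m -> J0 R m := fun x => \row_i g i x.
have sw : smooth V w.
  move=> k; apply/(class_C_mxP k (w : J0 R m -> 'rV[R]_(1 + m)) oV) => i j.
  by apply: class_C_eq (sg j k) => // x _; rewrite mxE.
have wE i x : V x -> 'D_(E i x) w x = delta_mx 0 i :> 'rV[R]_(1 + m).
  move=> Vx; have dw : derivable w x (E i x) by exact: class_C_derivable (sw 1%N) Vx.
  rewrite (derive_mx dw); apply/rowP => j; rewrite !mxE eqxx /=.
  by under eq_fun do rewrite mxE; rewrite gE.
have [V' [oV' V'V V'z winj]] := local_injectivity oV Vz (sw 1%N) (fun i => wE i z Vz) (Mu _ Vz).
exists V', w; split=> //; split=> //.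
- by move=> x /V'V /VU.
- by move=> k; apply: class_C_sub V'V _; exact: sw.
exists e; split.
- by rewrite /basis_of /= ss' -As eqxx.
- by move=> i; apply: sP; apply: s's; exact: (mem_tnth i e).
by move=> i x /V'V; exact: wE.
Qed.

(** The prolonged vector at this jet is [(0, 0, eta2)], so along it [f] stays constant and the
    tangency condition reduces to its last component. *)
Lemma symmetry_isotropy (X : 'M[R]_n) z p q : X \in slv R n -> Om (z, p) ->
  q = f (z, p) -> phi X z = 0 -> eta1 (phi X) (z, p) = 0 ->
  eta2 (phi X) (z, p, q) = 0.
Proof.
move=> Xs Omj qE X0 e0; case: symOm => symX _ _ _ _.
have [_ /(_ (z, p, q) (conj Omj qE))] := symX _ Xs.
rewrite derive_line /prolong2 /prolong1 /= X0 e0.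
set y := eta2 _ _.
have -> : (fun t : R => (t *: ((0, 0, y) : J2 R m) + (z, p, q)).2 -
                        f (t *: ((0, 0, y) : J2 R m) + (z, p, q)).1) =
          (fun t : R => t *: y + (q - f (z, p))).
  apply/funext => t; rewrite /= addrA; congr (_ - f (_, _)).
    by rewrite scaler0 add0r.
  by rewrite scaler0 add0r.
have := is_derive_line (@derivable_id R _ (q - f (z, p)) y).
by rewrite derive_id => -[_ ->].
Qed.

Lemma canonical_coordinates_trivial A V w : positive_abelian P A ->
  canonical_coordinates U phi P A V w -> becomes_trivial Om f V w.
Proof.
move=> PA [oV VU sw _ [e [be eP wE]]] [[z p] q] /= Omj Vz.
have Uz := VU _ Vz; have Asl := positive_abelian_slv PA.
have [_ Aabel] := PA.
have [H Hs HA] := abelian_grading PA.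
have eA i : tnth e i \in A by apply: (basis_mem be); exact: mem_tnth.
have es i : tnth e i \in slv R n by apply: (subvP Asl).
pose E i := phi (tnth e i).
have sE i : smooth V (E i) by move=> k; apply: class_C_sub VU _; exact: sym_smooth.
(* The derivative of [w] sends the fields to the standard basis, which forces their independence. *)
have Mu x : V x -> frame_mx E x \in unitmx.
  move=> Vx; apply: frame_unitmx => c c0 i.
  have := derive_sum_dir (index_enum _) c (fun i => E i x) oV Vx (sw 1%N).
  rewrite c0 derive0 => /esym/rowP/(_ i); rewrite summxE mxE (bigD1 i) //= wE //.
  rewrite !mxE !eqxx mulr1 big1 ?addr0 // => j ji.
  by rewrite wE // !mxE eqxx eq_sym (negPf ji) mulr0.
have comm i j x : V x -> bracket (E i) (E j) x = 0.
  move=> /VU Ux; rewrite (sym_bracketE Ux (es i) (es j) (Aabel _ _ (eA i) (eA j))).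
  exact: (sym0 symOm).
have sH : smooth V (phi H) by move=> k; apply: class_C_sub VU _; exact: sym_smooth.
have [g [sg HE]] := frame_coefficients oV sE sH Mu.
(* The subtracted element lies in the abelian [A], so the brackets with the [tnth e j] are those of
   [H]. *)
pose Z := H - \sum_i g i z *: tnth e i.
have As : \sum_i g i z *: tnth e i \in A by apply: memv_suml => i _; exact: memvZ.
have Zs : Z \in slv R n by rewrite memvB // (subvP Asl).
pose g' i x := g i x - g i z.
have sg' i : smooth V (g' i).
  by move=> k; apply: class_CD => //; [exact: sg | exact: class_C_cst].
have ZE x : V x -> phi Z x = \sum_i g' i x *: E i x.
  move=> Vx; have Ux := VU _ Vx; rewrite (symB symOm Ux Hs (subvP Asl _ As)).
  rewrite (sym_sum symOm) // HE // -sumrB; apply: eq_bigr => i _.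
  by rewrite /g' scalerBl.
have brZ (j : 'I_(1 + m)) (y : J0 R m) : V y -> bracket (E j) (phi Z) y = E j y.
  move=> /VU Uy; apply: sym_bracketE => //.
  by rewrite /Z addrC -scaleN1r mxbracketDr (Aabel _ _ (eA j) As) scaler0 add0r HA.
have gE i j y : V y -> 'D_(E j y) (g' i) y = (i == j)%:R.
  apply: (frame_coefficients_derive oV (fun i => sE i 1%N) (fun i => sg' i 1%N) Mu ZE comm brZ).
have g0 i : g' i z = 0 by rewrite /g' subrr.
have [Zid Zdd] := frame_euler_field oV Vz sE sw sg' Mu ZE g0
  (fun i x => wE i x) gE.
have Z0 : phi Z z = 0 by rewrite ZE // big1 // => i _; rewrite g0 scale0r.
have sZ : smooth V (phi Z) by move=> k; apply: class_C_sub VU _; exact: sym_smooth.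
have eta1Z : eta1 (phi Z) (z, p) = 0.
  by rewrite (eta1E p Vz (sZ 1%N)) Zid dep_contact indep_contact scale1r subrr.
have dw x v : V x -> derivable w x v.
  by move=> Vx; exact: class_C_derivable (sw 1%N) Vx.
rewrite /Dx1 /= derive_indep; last exact: dw.
set d := contact p => i0.
pose a := 'D_d (fun x => 'D_d (phi Z) x) z.
have fE : f (z, p) = dep a - indep a *: p.
  have := symmetry_isotropy Zs Omj erefl Z0 eta1Z.
  by rewrite (eta2_linear_part_id p _ oV Vz (sZ 2%N) Zid) => /eqP; rewrite subr_eq0 => /eqP.
rewrite (new_q_eq0 q oV Vz (sw 2%N) i0) -/d.
have lin (c : R) (u v : J0 R m) : 'D_(c *: u + v) w z = c *: 'D_u w z + 'D_v w z :> J0 R m.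
  exact: derive_lincomb oV Vz (sw 1%N).
(* The vertical lift of [f] is [a] corrected along the velocity [d] to have zero independent
   component. Applying the derivative of [w] and [Zdd] turns this into parallelism of acceleration
   and velocity. *)
have vertE : vert (f (z, p)) = (- indep a) *: d + a.
  apply: J0_eq; rewrite (indep_vert, dep_vert) (indepD, depD) (indepZ, depZ).
    by rewrite indep_contact mulr1 addNr.
  by rewrite dep_contact fE scaleNr addrC.
split=> [->|[mu sE']].
  exists (- indep a); rewrite vertE lin Zdd addrC subrK.
  by [].
suff -> : q = dep a - indep a *: p by rewrite fE.
(* The derivative of [w] at [z] is injective by [dir_frame], so the parallelism relation can be
   pulled back. *)
have vq : vert q = mu *: d + a.
  apply/eqP; rewrite -subr_eq0; apply/eqP.
  have dv0 : 'D_(vert q - (mu *: d + a)) w z = 0.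
    rewrite addrC -scaleN1r lin lin Zdd -sE' scaleN1r.
    by rewrite [_ + _ - _]addrAC subrr add0r addNr.
  have vqE := @dir_frame _ _ V E w z (vert q - (mu *: d + a)) oV Vz (sw 1%N) (fun i => wE i z Vz) (Mu _ Vz).
  rewrite dv0 in vqE; apply: (etrans vqE); apply: big1 => i _.
  by rewrite [X in X *: _]mxE scale0r.
have muE : mu = - indep a.
  move/(congr1 (@indep R m)): (vq); rewrite indep_vert indepD indepZ indep_contact mulr1.
  by move=> /esym/eqP; rewrite addr_eq0 => /eqP.
move/(congr1 (@dep R m)): vq; rewrite dep_vert depD depZ dep_contact muE scaleNr.
by rewrite addrC.
Qed.

(** The part common to both cases; the existence of enough independent commuting root vectors at one
    point is supplied separately for sl(3) and sl(4). *)
Lemma canonical_linearization :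
  (exists z (s : seq 'M[R]_n), [/\ U z, size s = m.+1,
      forall X, X \in s -> exists2 al, P al & root_vector al X,
      forall X Y, X \in s -> Y \in s -> mxbracket X Y = 0
    & free [seq phi X z : 'rV[R]_(1 + m) | X <- s]]) ->
  (exists A, maximal_rank_abelian U phi P A) /\
  forall A, maximal_rank_abelian U phi P A ->
  [/\ geometric_rank U phi A = m.+1,
      forall z, U z -> rank_at phi A z = m.+1 ->
        exists V w, V z /\ canonical_coordinates U phi P A V w
    & forall V w, canonical_coordinates U phi P A V w ->
        becomes_trivial Om f V w].
Proof.
move=> [z [s [Uz sz sP sabel fs]]]; split.
  exact: maximal_rank_abelian_exists.
move=> A Amax; have [[PA _] _] := Amax; split.
- exact: (maximal_rank_abelian_full symOm Uz sP sabel fs sz Amax).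
- by move=> x; exact: canonical_coordinates_exist.
by move=> V w; exact: canonical_coordinates_trivial.
Qed.

End CanonicalCoordinates.

Theorem proposition4p1 (R : realType) :
  (forall (Om : set (J1 R 1)) (f : J1 R 1 -> 'rV[R]_1)
     (phi : 'M[R]_3 -> vfield R 1),
     open Om -> Om !=set0 -> smooth Om f ->
     sl_is_symmetry_algebra Om f phi ->
     forall (h : {vspace 'M[R]_3}) (P : set (dual h)),
     split_cartan h -> positive_roots P ->
     (exists A, maximal_rank_abelian (base Om) phi P A) /\
     forall A, maximal_rank_abelian (base Om) phi P A ->
     [/\ geometric_rank (base Om) phi A = 2%N,
         forall z, base Om z -> rank_at phi A z = 2%N ->
           exists V w, V z /\ canonical_coordinates (base Om) phi P A V w
       & forall V w, canonical_coordinates (base Om) phi P A V w ->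
           becomes_trivial Om f V w])
  /\
  (forall (Om : set (J1 R 2)) (f : J1 R 2 -> 'rV[R]_2)
     (phi : 'M[R]_4 -> vfield R 2),
     open Om -> Om !=set0 -> smooth Om f ->
     sl_is_symmetry_algebra Om f phi ->
     forall (h : {vspace 'M[R]_4}) (P : set (dual h)),
     split_cartan h -> positive_roots P ->
     (exists A, maximal_rank_abelian (base Om) phi P A) /\
     forall A, maximal_rank_abelian (base Om) phi P A ->
     [/\ geometric_rank (base Om) phi A = 3%N,
         forall z, base Om z -> rank_at phi A z = 3%N ->
           exists V w, V z /\ canonical_coordinates (base Om) phi P A V w
       & forall V w, canonical_coordinates (base Om) phi P A V w ->
           becomes_trivial Om f V w]).
Proof.
split=> Om f phi oOm _ _ symOm h P hC hP.
  exact: (canonical_linearization oOm symOm hC hP (sl3_full_rank symOm hC hP)).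
exact: (canonical_linearization oOm symOm hC hP (sl4_full_rank symOm hC hP)).
Qed.
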